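(* There exist a finite set of colors $C$ with a distinguished color $c_0\in C$ and a tiling system $T\subseteq C^4$ over $C$ such that the following zero tiling sum problem is undecidable: given a finitely supported mapping $f_0:\mathscr E\times C\to\mathbb Z$, decide whether there exists a tiling sum $f$ over $T$ with $f_0+f=0$.
   Context: Let $\mathscr E=\{\{(p,q),(r,s)\}: p,q,r,s\in\mathbb Z,\ |p-r|+|q-s|=1\}$ be the set of edges of the Cayley graph of $\mathbb Z\times\mathbb Z$ (the unit grid), with translation $e+(a,b)$ defined by translating both endpoints. A tiling system over $C$ is a set $T\subseteq C^4$ of tiles $t=(c_N,c_E,c_S,c_W)$ (north, east, south, west colors). With $\delta$ the Kronecker delta, each tile $t$ defines $[\![t]\!]:\mathscr E\times C\to\mathbb Z$ by $[\![t]\!](\{(0,0),(1,0)\},c_S)=-(1-\delta_{c_S,c_0})$, $[\![t]\!](\{(1,0),(1,1)\},c_E)=1-\delta_{c_E,c_0}$, $[\![t]\!](\{(1,1),(0,1)\},c_N)=1-\delta_{c_N,c_0}$, $[\![t]\!](\{(0,1),(0,0)\},c_W)=-(1-\delta_{c_W,c_0})$, and $[\![t]\!](e,c)=0$ in all other cases. For $f:\mathscr E\times C\to\mathbb Z$ and $(a,b)\in\mathbb Z^2$, the translate is $\tau_{a,b}f(e,c)=f(e-(a,b),c)$; sums of such maps are pointwise. A map has finite support if it is nonzero at only finitely many arguments. A tiling sum over $T$ is a sum $\sum_{i=1}^n\tau_{x_i,y_i}[\![t_i]\!]$ with $n\ge 0$, $x_i,y_i\in\mathbb Z$, $t_i\in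 T$ (repetitions of positions and tiles allowed). *)

(* Defs.v *)
From Stdlib Require Import ZArith List Arith.
Import ListNotations.
Open Scope Z_scope.

Inductive code : Type :=
| Zero : code
| Succ : code
| Proj : nat -> code
| Comp : code -> list code -> code
| Prec : code -> code -> code
| Mu   : code -> code.

Inductive eval : code -> list nat -> nat -> Prop :=
| eZero v : eval Zero v 0
| eSucc x v : eval Succ (x :: v) (S x)
| eProj i v : (i < length v)%nat -> eval (Proj i) v (nth i v 0%nat)
| eComp f gs v ws y : evals gs v ws -> eval f ws y -> eval (Comp f gs) v y
| ePrec0 f g v y : eval f v y -> eval (Prec f g) (0%nat :: v) y
| ePrecS f g n v r y :
    eval (Prec f g) (n :: v) r -> eval g (n :: r :: v) y ->
    eval (Prec f g) (S n :: v) y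
| eMu f v n :
    eval f (n :: v) 0%nat ->
    (forall m, (m < n)%nat -> exists k, eval f (m :: v) (S k)) ->
    eval (Mu f) v n
with evals : list code -> list nat -> list nat -> Prop :=
| esNil v : evals nil v nil
| esCons g gs v y ys : eval g v y -> evals gs v ys -> evals (g :: gs) v (y :: ys).

Definition decidable_nat (P : nat -> Prop) : Prop :=
  exists e : code, forall n : nat,
    (P n -> eval e [n] 0%nat) /\ (~ P n -> eval e [n] 1%nat).

Definition undecidable_nat (P : nat -> Prop) : Prop := ~ decidable_nat P.

(* Cantor enumeration of nat * nat (a computable bijection nat -> nat*nat). *)
Fixpoint unpair (n : nat) : nat * nat :=
  match n with
  | O => (0%nat, 0%nat)
  | S m => let (x, y) := unpair m in
           match x with
           | O => (S y, 0%nat)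
           | S x' => (x', S y)
           end
  end.

Fixpoint dlist_fuel (fuel n : nat) : list nat :=
  match fuel with
  | O => nil
  | S fuel' =>
      match n with
      | O => nil
      | S m => let (h, t) := unpair m in h :: dlist_fuel fuel' t
      end
  end.
Definition dlist (n : nat) : list nat := dlist_fuel n n.

Definition zdec (n : nat) : Z :=
  if Nat.even n then Z.of_nat (Nat.div2 n) else - Z.of_nat (S (Nat.div2 n)).

(* Colours: C = {0, ..., k-1} (as naturals c < k), distinguished c0.    *)
(* An edge {u, v} of the grid is given by its two endpoints (unordered). *)
(* Maps E x C -> Z are represented by functions of (u, v, c), and only  *)
(* evaluated on edges {u, v}; all maps below are symmetric in u, v.     *)
Definition point := (Z * Z)%type.

Definition adjacent (u v : point) : Prop :=
  Z.abs (fst u - fst v) + Z.abs (snd u - snd v) = 1.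

Definition pt_eqb (u v : point) : bool :=
  Z.eqb (fst u) (fst v) && Z.eqb (snd u) (snd v).

Definition same_edge (u v a b : point) : bool :=
  (pt_eqb u a && pt_eqb v b) || (pt_eqb u b && pt_eqb v a).

Definition emap := point -> point -> nat -> Z.

(* tile (c_N, c_E, c_S, c_W) *)
Definition tile := (nat * nat * nat * nat)%type.

Definition tile_ok (k : nat) (t : tile) : Prop :=
  match t with (cN, cE, cS, cW) => (cN < k /\ cE < k /\ cS < k /\ cW < k)%nat end.

Definition nd (c0 c : nat) : Z := if Nat.eqb c c0 then 0 else 1.

Definition at_color (c c' : nat) (z : Z) : Z := if Nat.eqb c c' then z else 0.

Definition tile_map (c0 : nat) (t : tile) : emap :=
  fun u v c =>
    match t with (cN, cE, cS, cW) =>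
        (if same_edge u v (0, 0) (1, 0) then at_color c cS (- nd c0 cS) else 0)
      + (if same_edge u v (1, 0) (1, 1) then at_color c cE (nd c0 cE) else 0)
      + (if same_edge u v (1, 1) (0, 1) then at_color c cN (nd c0 cN) else 0)
      + (if same_edge u v (0, 1) (0, 0) then at_color c cW (- nd c0 cW) else 0)
    end.

Definition translate (a b : Z) (f : emap) : emap :=
  fun u v c => f (fst u - a, snd u - b) (fst v - a, snd v - b) c.

Definition tiling_sum (c0 : nat) (L : list (Z * Z * tile)) : emap :=
  fun u v c =>
    fold_right (fun '(x, y, t) acc => translate x y (tile_map c0 t) u v c + acc) 0 L.

Definition zero_tiling_sum (k c0 : nat) (T : list tile) (f0 : emap) : Prop :=
  exists L : list (Z * Z * tile),
    (forall x y t, In (x, y, t) L -> In t T) /\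
    forall u v : point, adjacent u v ->
      forall c : nat, (c < k)%nat -> f0 u v c + tiling_sum c0 L u v c = 0.

(* Encoding of finitely supported maps f0 : E x C -> Z by naturals.    *)
(* n encodes the list of entries dlist n; each entry m encodes         *)
(* (p, q, r, s, c, z) via dlist m, contributing the value z at         *)
(* ({(p,q),(r,s)}, c).  f0 is the sum of the contributions.  Every      *)
(* finitely supported map arises this way (entries that are not edges   *)
(* or not colours are irrelevant).                                      *)
Definition entry_map (m : nat) : emap :=
  let l := dlist m in
  let p := zdec (nth 0 l 0%nat) in
  let q := zdec (nth 1 l 0%nat) in
  let r := zdec (nth 2 l 0%nat) in
  let s := zdec (nth 3 l 0%nat) in
  let col := nth 4 l 0%nat in
  let z := zdec (nth 5 l 0%nat) in
  fun u v c => if same_edge u v (p, q) (r, s) then at_color c col z else 0.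

Definition input_map (n : nat) : emap :=
  fun u v c => fold_right (fun m acc => entry_map m u v c + acc) 0 (dlist n).

(* Main.v *)
Require Import Defs.
From Stdlib Require Import ZArith List Arith.
From Stdlib Require Import Lia Bool FunctionalExtensionality ClassicalEpsilon.
(* Imported again because Stdlib shadows [Prec]. *)
Import Defs ListNotations.

(* A tiling sum is a nonnegative integer combination of translated vectors, so
   one can prescribe any finite list of generators that consume and produce
   coloured tokens on horizontal edges: a generator is a chain of tiles glued
   along private colours. The tokens simulate a machine that acts on a number n
   by replacing it with p n / d if d divides it: the token of n at (n, 0) walks
   in direction (-d, 1) until it meets the line x = n mod d, then in direction
   (p, -1) back to the line y = 0. Reaching a line is certified by an extra
   token that can only be absorbed there, by one token climbing along that line
   and absorbing one certificate per step; it can climb arbitrarily high, so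
   the number of tests is not limited.

   That no tiling sum exists when the machine does not accept is shown by
   linear duality: some potential on (edge, colour) pairs is nonnegative on all
   translates of all tiles within the (bounded) support of a given sum and
   positive on the input.

   The machine accepts n when u(n) is nonzero, for a fixed recursive function u
   that interprets its input n as a code and runs it on n. A decision procedure,
   composed with the reduction, is a code D that returns 0 exactly on accepted
   inputs; on its own code it agrees with u, so it is wrong there. *)

Local Open Scope nat_scope.

(** * A universal recursive function *)

(** All tiles may be used at every translate, so only the input can single out a line, and a finite
    input has to serve unboundedly many tests. This is why a token climbs along the line instead of
    the input supplying absorbers. Moreover a sum has no order of events: a generator can consume a
    token that no genuine run produces, with the debt settled elsewhere, and tiles can be taken out
    of their chains. An induction along a run therefore cannot exclude spurious sums, whereas a
    potential is insensitive to order and to regrouping; the one used counts the state tokens that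
    genuine runs reach.

    A number is stored as a position because a walk in direction (-d, 1) keeps x + d y constant and
    so divides by d without any counter. Recursive functions get down to such machines through loop
    programs, whose registers become exponents of pairwise coprime bases inside one number. *)

Definition computable (k : nat) (F : list nat -> nat) : Prop :=
  exists c, forall v, length v = k -> eval c v (F v).

Lemma computable_ext k F G :
  (forall v, length v = k -> F v = G v) -> computable k F -> computable k G.
Proof.
  intros E [c H]. exists c. intros v Hv. rewrite <- E by exact Hv. auto.
Qed.

Lemma computable_nth k i : i < k -> computable k (fun v => nth i v 0).
Proof. intros H. exists (Proj i). intros v Hv. constructor. lia. Qed.

Lemma computable_comp k m (f : list nat -> nat) (Gs : list (list nat -> nat)) :
  computable m f -> length Gs = m -> Forall (computable k) Gs ->
  computable k (fun v => f (map (fun G => G v) Gs)).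
Proof.
  intros [cf Hf] Hm HG.
  assert (exists cs, forall v, length v = k ->
            evals cs v (map (fun G => G v) Gs)) as [cs Hcs].
  { clear Hm. induction HG as [|G Gs [c Hc] _ [cs Hcs]].
    - exists nil. intros; constructor.
    - exists (c :: cs). intros v Hv. constructor; auto. }
  exists (Comp cf cs). intros v Hv. econstructor; [apply Hcs, Hv|].
  apply Hf. now rewrite length_map.
Qed.

Lemma computable_comp1 k (f : nat -> nat) A :
  computable 1 (fun v => f (nth 0 v 0)) -> computable k A ->
  computable k (fun v => f (A v)).
Proof.
  intros Hf HA. apply (computable_comp k 1 _ [A] Hf eq_refl). auto.
Qed.

Lemma computable_comp2 k (f : nat -> nat -> nat) A B :
  computable 2 (fun v => f (nth 0 v 0) (nth 1 v 0)) ->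
  computable k A -> computable k B -> computable k (fun v => f (A v) (B v)).
Proof.
  intros Hf HA HB. apply (computable_comp k 2 _ [A; B] Hf eq_refl). auto.
Qed.

Lemma computable_comp3 k (f : nat -> nat -> nat -> nat) A B C :
  computable 3 (fun v => f (nth 0 v 0) (nth 1 v 0) (nth 2 v 0)) ->
  computable k A -> computable k B -> computable k C ->
  computable k (fun v => f (A v) (B v) (C v)).
Proof.
  intros Hf HA HB HC. apply (computable_comp k 3 _ [A; B; C] Hf eq_refl). auto.
Qed.

Lemma computable_succ k A : computable k A -> computable k (fun v => S (A v)).
Proof.
  apply computable_comp1. exists Succ.
  intros [|x [|]] H; try discriminate. constructor.
Qed.

Lemma computable_const k n : computable k (fun _ => n).
Proof.
  induction n as [|n IH].
  - exists Zero. intros; constructor.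
  - now apply computable_succ in IH.
Qed.

Lemma evals_proj k : forall v, length v = k -> evals (map Proj (seq 0 k)) v v.
Proof.
  intros v Hv.
  assert (H : forall i w, i + length w = k -> skipn i v = w ->
            evals (map Proj (seq i (length w))) v w).
  { intros i w. revert i. induction w as [|y w IH]; intros i Hi Hs; simpl; constructor.
    - assert (y = nth i v 0) as ->.
      { replace i with (i + 0) by lia. rewrite <- nth_skipn, Hs. reflexivity. }
      constructor. simpl in Hi; lia.
    - apply IH; [simpl in Hi; lia|].
      change w with (skipn 1 (y :: w)). rewrite <- Hs, skipn_skipn. f_equal; lia. }
  specialize (H 0 v Hv eq_refl). now rewrite Hv in H.
Qed.

Lemma computable_rec k N F G :
  computable k N -> computable k F -> computable (S (S k)) G ->
  computable k (fun v => nat_rect (fun _ => nat) (F v) (fun n r => G (n :: r :: v)) (N v)).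
Proof.
  intros [cN HN] [cF HF] [cG HG].
  exists (Comp (Prec cF cG) (cN :: map Proj (seq 0 k))). intros v Hv.
  econstructor.
  - constructor; [apply HN, Hv | apply evals_proj, Hv].
  - induction (N v) as [|n IH]; simpl; econstructor; eauto.
    apply HG. simpl; lia.
Qed.

Definition ite (c a b : nat) : nat := match c with 0 => a | S _ => b end.

Lemma computable_ite k A B C :
  computable k A -> computable k B -> computable k C ->
  computable k (fun v => ite (A v) (B v) (C v)).
Proof.
  apply computable_comp3.
  eapply computable_ext with
    (F := fun v => nat_rect (fun _ => nat) (nth 1 v 0)
       (fun n r => (fun w => nth 4 w 0) (n :: r :: v)) (nth 0 v 0)).
  - intros v _. destruct (nth 0 v 0); reflexivity.
  - apply (computable_rec 3 (fun v => nth 0 v 0) (fun v => nth 1 v 0)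
      (fun w => nth 4 w 0)); apply computable_nth; lia.
Qed.

Lemma computable_pred k A : computable k A -> computable k (fun v => pred (A v)).
Proof.
  apply computable_comp1.
  eapply computable_ext with
    (F := fun v => nat_rect (fun _ => nat) 0
       (fun n r => (fun w => nth 0 w 0) (n :: r :: v)) (nth 0 v 0)).
  - intros v _. destruct (nth 0 v 0); reflexivity.
  - apply (computable_rec 1 (fun v => nth 0 v 0) (fun _ => 0) (fun w => nth 0 w 0));
      first [apply computable_nth; lia | apply computable_const].
Qed.

Lemma computable_add k A B :
  computable k A -> computable k B -> computable k (fun v => A v + B v).
Proof.
  apply computable_comp2.
  eapply computable_ext with
    (F := fun v => nat_rect (fun _ => nat) (nth 1 v 0)
       (fun n r => (fun w => S (nth 1 w 0)) (n :: r :: v)) (nth 0 v 0)).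
  - intros v _. cbn beta. induction (nth 0 v 0); simpl in *; congruence.
  - apply (computable_rec 2 (fun v => nth 0 v 0) (fun v => nth 1 v 0)
      (fun w => S (nth 1 w 0))); try apply computable_succ; apply computable_nth; lia.
Qed.

Lemma computable_sub k A B :
  computable k A -> computable k B -> computable k (fun v => A v - B v).
Proof.
  apply computable_comp2.
  eapply computable_ext with
    (F := fun v => nat_rect (fun _ => nat) (nth 0 v 0)
       (fun n r => (fun w => pred (nth 1 w 0)) (n :: r :: v)) (nth 1 v 0)).
  - intros v _. cbn beta. induction (nth 1 v 0); simpl in *; lia.
  - apply (computable_rec 2 (fun v => nth 1 v 0) (fun v => nth 0 v 0)
      (fun w => pred (nth 1 w 0))); try apply computable_pred; apply computable_nth; lia.
Qed.

Lemma computable_pow2 k A : computable k A -> computable k (fun v => 2 ^ A v).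
Proof.
  apply computable_comp1.
  eapply computable_ext with
    (F := fun v => nat_rect (fun _ => nat) 1
       (fun n r => (fun w => nth 1 w 0 + nth 1 w 0) (n :: r :: v)) (nth 0 v 0)).
  - intros v _. cbn beta. induction (nth 0 v 0); simpl in *; lia.
  - apply (computable_rec 1 (fun v => nth 0 v 0) (fun _ => 1)
      (fun w => nth 1 w 0 + nth 1 w 0)); [apply computable_nth; lia | apply computable_const |].
    apply computable_add; apply computable_nth; lia.
Qed.

(** * Cantor pairing and coded lists *)

Definition tri (n : nat) : nat := nat_rect (fun _ => nat) 0 (fun n r => S (n + r)) n.

Arguments tri : simpl never.

Lemma tri_S n : tri (S n) = S (n + tri n).
Proof. reflexivity. Qed.

Lemma computable_tri k A : computable k A -> computable k (fun v => tri (A v)).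
Proof.
  apply computable_comp1.
  apply (computable_rec 1 (fun v => nth 0 v 0) (fun _ => 0)
    (fun w => S (nth 0 w 0 + nth 1 w 0))).
  - apply computable_nth; lia.
  - apply computable_const.
  - apply computable_succ, computable_add; apply computable_nth; lia.
Qed.

(** The inverse of [unpair], which runs through each diagonal x + y = s from (s, 0) to (0, s), after
    the [tri s] pairs of the shorter diagonals. *)
Definition cpair (x y : nat) : nat := tri (x + y) + y.
Arguments cpair : simpl never.
Definition pfst (n : nat) : nat := fst (unpair n).
Definition psnd (n : nat) : nat := snd (unpair n).

Lemma computable_pair k A B :
  computable k A -> computable k B -> computable k (fun v => cpair (A v) (B v)).
Proof.
  intros. apply computable_add; [apply computable_tri, computable_add|]; auto.
Qed.

Lemma unpair_S n : unpair (S n) =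
  match unpair n with (0, y) => (S y, 0) | (S x, y) => (x, S y) end.
Proof. simpl. now destruct (unpair n) as [[|x] y]. Qed.

Lemma unpair_pair x y : unpair (cpair x y) = (x, y).
Proof.
  assert (H : forall s y x, x + y = s -> unpair (cpair x y) = (x, y)).
  { clear. intros s. induction s as [|s IHs].
    - intros y x H. destruct x, y; try lia. reflexivity.
    - induction y as [|y IHy]; intros x H.
      + replace x with (S s) by lia.
        replace (cpair (S s) 0) with (S (cpair 0 s)) by
          (unfold cpair; rewrite !Nat.add_0_r, tri_S; simpl; lia).
        rewrite unpair_S. rewrite IHs by lia. reflexivity.
      + replace (cpair x (S y)) with (S (cpair (S x) y)) by
          (unfold cpair; replace (x + S y) with (S x + y) by lia; lia).
        rewrite unpair_S. rewrite IHy by lia. reflexivity. }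
  eapply H; reflexivity.
Qed.

Lemma pfst_pair x y : pfst (cpair x y) = x.
Proof. unfold pfst. now rewrite unpair_pair. Qed.

Lemma psnd_pair x y : psnd (cpair x y) = y.
Proof. unfold psnd. now rewrite unpair_pair. Qed.

Lemma unpair_inv n x y : unpair n = (x, y) -> n = cpair x y.
Proof.
  revert x y. induction n as [|n IH]; intros x y.
  - intros [= <- <-]. reflexivity.
  - rewrite unpair_S. destruct (unpair n) as [[|a] b]; intros [= <- <-];
      rewrite (IH _ _ eq_refl); unfold cpair.
    + rewrite !Nat.add_0_r, tri_S. simpl. lia.
    + replace (a + S b) with (S a + b) by lia. lia.
Qed.

Lemma pair_unpair n : n = cpair (pfst n) (psnd n).
Proof. apply unpair_inv, surjective_pairing. Qed.

(** The index x + y of the diagonal containing the pair number n. It grows exactly when [S m]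
    reaches [tri (S s)], the first number of the next diagonal. Both projections are then arithmetic
    in n and [diag n], which avoids a recursion that returns pairs. *)
Definition diag (n : nat) : nat :=
  nat_rect (fun _ => nat) 0 (fun m s => ite (tri (S s) - S m) (S s) s) n.

Lemma diag_spec n : diag n = pfst n + psnd n.
Proof.
  induction n as [|n IH]; [reflexivity|].
  change (diag (S n)) with (ite (tri (S (diag n)) - S n) (S (diag n)) (diag n)).
  rewrite IH. unfold pfst, psnd. rewrite unpair_S.
  destruct (unpair n) as [x y] eqn:E. apply unpair_inv in E. simpl fst; simpl snd.
  unfold cpair in E. rewrite tri_S. destruct x as [|x]; simpl fst; simpl snd.
  - replace (S (0 + y + tri (0 + y)) - S n) with 0 by lia. simpl. lia.
  - replace (S (S x + y + tri (S x + y)) - S n) with (S x) by lia. simpl. lia.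
Qed.

Lemma computable_diag k A : computable k A -> computable k (fun v => diag (A v)).
Proof.
  apply computable_comp1.
  apply (computable_rec 1 (fun v => nth 0 v 0) (fun _ => 0)
    (fun w => ite (tri (S (nth 1 w 0)) - S (nth 0 w 0)) (S (nth 1 w 0)) (nth 1 w 0))).
  - apply computable_nth; lia.
  - apply computable_const.
  - apply computable_ite; [apply computable_sub; [apply computable_tri|]| |];
      try apply computable_succ; apply computable_nth; lia.
Qed.

Lemma computable_psnd k A : computable k A -> computable k (fun v => psnd (A v)).
Proof.
  intros H. apply computable_ext with (F := fun v => A v - tri (diag (A v))).
  - intros v _. rewrite diag_spec. pose proof (pair_unpair (A v)) as E.
    unfold cpair in E. lia.
  - apply computable_sub; [|apply computable_tri, computable_diag]; exact H.
Qed.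

Lemma computable_pfst k A : computable k A -> computable k (fun v => pfst (A v)).
Proof.
  intros H. apply computable_ext with (F := fun v => diag (A v) - psnd (A v)).
  - intros v _. rewrite diag_spec. lia.
  - apply computable_sub; [apply computable_diag | apply computable_psnd]; exact H.
Qed.

(** The format that [dlist] decodes, with 0 as the empty list, so the same lists serve the
    interpreter and the output of the reduction. *)
Definition lcons (h t : nat) : nat := S (cpair h t).
Definition lhd (l : nat) : nat := pfst (pred l).
Definition ltl (l : nat) : nat := psnd (pred l).
Definition lnth (i l : nat) : nat := lhd (nat_rect (fun _ => nat) l (fun _ r => ltl r) i).
Definition elist (l : list nat) : nat := fold_right lcons 0 l.

Lemma hd_lcons h t : lhd (lcons h t) = h.
Proof. apply pfst_pair. Qed.

Lemma tl_lcons h t : ltl (lcons h t) = t.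
Proof. apply psnd_pair. Qed.

Lemma nth_elist i l : i < length l -> lnth i (elist l) = nth i l 0.
Proof.
  assert (H : forall i l, nat_rect (fun _ => nat) (ltl l) (fun _ r => ltl r) i
                     = ltl (nat_rect (fun _ => nat) l (fun _ r => ltl r) i)).
  { clear. intros i l. induction i; simpl; congruence. }
  revert i. induction l as [|x l IH]; intros [|i] Hi; simpl in *; try lia.
  - apply hd_lcons.
  - rewrite <- IH by lia. unfold lnth. simpl. now rewrite <- H, tl_lcons.
Qed.

Lemma dlist_elist l : dlist (elist l) = l.
Proof.
  assert (H : forall l f, length l <= f -> dlist_fuel f (elist l) = l).
  { clear. induction l as [|x l IH]; intros [|f] Hf; simpl in *; try lia; try reflexivity.
    rewrite unpair_pair. f_equal. apply IH. lia. }
  (* A coded list is at least as large as its length, so the number itself is enough fuel. *)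
  apply H. induction l as [|x l IH]; [simpl; lia|].
  change (elist (x :: l)) with (S (cpair x (elist l))). unfold cpair. simpl length. lia.
Qed.

Lemma computable_cons k A B :
  computable k A -> computable k B -> computable k (fun v => lcons (A v) (B v)).
Proof. intros. now apply computable_succ, computable_pair. Qed.

Lemma computable_hd k A : computable k A -> computable k (fun v => lhd (A v)).
Proof. intros. now apply computable_pfst, computable_pred. Qed.

Lemma computable_tl k A : computable k A -> computable k (fun v => ltl (A v)).
Proof. intros. now apply computable_psnd, computable_pred. Qed.

Lemma computable_lnth k A B :
  computable k A -> computable k B -> computable k (fun v => lnth (A v) (B v)).
Proof.
  apply computable_comp2, computable_hd.
  apply (computable_rec 2 (fun v => nth 0 v 0) (fun v => nth 1 v 0)
    (fun w => ltl (nth 1 w 0))); try apply computable_tl; apply computable_nth; lia.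
Qed.

Ltac computability :=
  repeat first
    [ apply computable_const | apply computable_nth; lia | apply computable_ite
    | apply computable_lnth | apply computable_cons | apply computable_hd
    | apply computable_tl | apply computable_pair | apply computable_pfst
    | apply computable_psnd | apply computable_pow2 | apply computable_add
    | apply computable_pred | apply computable_succ ].

(** * An interpreter for codes *)

(** The evaluations required by [eMu] below the minimum sit under an existential. The fixpoint opens
    it, so that [P] is available for those subderivations too. *)
Lemma eval_induction (P : code -> list nat -> nat -> Prop)
  (Q : list code -> list nat -> list nat -> Prop) :
  (forall v, P Zero v 0) ->
  (forall x v, P Succ (x :: v) (S x)) ->
  (forall i v, i < length v -> P (Proj i) v (nth i v 0)) ->
  (forall f gs v ws y, evals gs v ws -> Q gs v ws -> P f ws y -> P (Comp f gs) v y) ->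
  (forall f g v y, P f v y -> P (Prec f g) (0 :: v) y) ->
  (forall f g n v r y, P (Prec f g) (n :: v) r -> P g (n :: r :: v) y ->
     P (Prec f g) (S n :: v) y) ->
  (forall f v n, P f (n :: v) 0 ->
     (forall m, m < n -> exists k, P f (m :: v) (S k)) -> P (Mu f) v n) ->
  (forall v, Q nil v nil) ->
  (forall g gs v y ys, P g v y -> Q gs v ys -> Q (g :: gs) v (y :: ys)) ->
  forall c v y, eval c v y -> P c v y.
Proof.
  intros H0 H1 H2 H3 H4 H5 H6 H7 H8.
  exact (fix IH c v y (H : eval c v y) {struct H} : P c v y :=
    match H with
    | eZero v => H0 v
    | eSucc x v => H1 x v
    | eProj i v h => H2 i v h
    | eComp f gs v ws y hs h => H3 f gs v ws y hs (IHs gs v ws hs) (IH _ _ _ h)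
    | ePrec0 f g v y h => H4 f g v y (IH _ _ _ h)
    | ePrecS f g n v r y h1 h2 => H5 f g n v r y (IH _ _ _ h1) (IH _ _ _ h2)
    | eMu f v n h hm => H6 f v n (IH _ _ _ h)
        (fun m hlt => match hm m hlt with
                      | ex_intro _ k hk => ex_intro _ k (IH _ _ _ hk)
                      end)
    end
  with IHs gs v ws (H : evals gs v ws) {struct H} : Q gs v ws :=
    match H with
    | esNil v => H7 v
    | esCons g gs v y ys h hs => H8 g gs v y ys (IH _ _ _ h) (IHs _ _ _ hs)
    end
  for IH).
Qed.

(* The argument list of [Comp] is stored in reverse, so that evaluating it
   from the head and consing the values restores the original order. *)
Fixpoint enc (c : code) : nat :=
  match c with
  | Zero => cpair 0 (cpair 0 0)
  | Succ => cpair 1 (cpair 0 0)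
  | Proj i => cpair 2 (cpair i 0)
  | Comp f gs => cpair 3 (cpair (enc f)
      ((fix encs gs acc := match gs with
                           | nil => acc
                           | g :: gs => encs gs (lcons (enc g) acc)
                           end) gs 0))
  | Prec f g => cpair 4 (cpair (enc f) (enc g))
  | Mu f => cpair 5 (cpair (enc f) 0)
  end.

(** A name for the local fixpoint in [enc], convertible to it. *)
Definition encs : list code -> nat -> nat :=
  fix encs gs acc := match gs with
                     | nil => acc
                     | g :: gs => encs gs (lcons (enc g) acc)
                     end.

Definition frame (tag a b v : nat) : nat := cpair (cpair tag (cpair a b)) v.

(* A configuration pairs the last returned value with a stack of frames.
   Tags 0-5 are pending evaluations of a code on [v]; tags 6 and 7 run
   through the arguments of a [Comp] ([v] holds the input and the values
   collected so far), 8 resumes a [Prec], 9 resumes a [Mu]. *)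
Definition step (c : nat) : nat :=
  let y := pfst c in
  let fr := lhd (psnd c) in
  let K := ltl (psnd c) in
  let code := pfst fr in
  let v := psnd fr in
  let tag := pfst code in
  let a := pfst (psnd code) in
  let b := psnd (psnd code) in
  let go K' := cpair y K' in
  ite (psnd c) c
  (ite tag (cpair 0 K)
  (ite (tag - 1) (cpair (S (lhd v)) K)
  (ite (tag - 2) (cpair (lnth a v) K)
  (ite (tag - 3) (go (lcons (frame 6 a b (cpair v 0)) K))
  (ite (tag - 4)
     (ite (lhd v) (go (lcons (cpair a (ltl v)) K))
        (go (lcons (cpair code (lcons (pred (lhd v)) (ltl v)))
                   (lcons (frame 8 b (pred (lhd v)) (ltl v)) K))))
  (ite (tag - 5) (go (lcons (cpair a (lcons 0 v)) (lcons (frame 9 a 0 v) K)))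
  (ite (tag - 6)
     (ite b (go (lcons (cpair a (psnd v)) K))
        (go (lcons (cpair (lhd b) (pfst v)) (lcons (frame 7 a (ltl b) v) K))))
  (ite (tag - 7) (go (lcons (frame 6 a b (cpair (pfst v) (lcons y (psnd v)))) K))
  (ite (tag - 8) (go (lcons (cpair a (lcons b (lcons y v))) K))
     (ite y (cpair b K)
        (go (lcons (cpair a (lcons (S b) v)) (lcons (frame 9 a (S b) v) K))))))))))))).

Definition steps (t c : nat) : nat := nat_rect (fun _ => nat) c (fun _ r => step r) t.

Lemma steps_add s t c : steps (s + t) c = steps s (steps t c).
Proof. induction s; simpl; congruence. Qed.

Definition leads (c c' : nat) : Prop := exists t, steps t c = c'.

Lemma leads_refl c : leads c c.
Proof. now exists 0. Qed.

Lemma leads_trans c c' c'' : leads c c' -> leads c' c'' -> leads c c''.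
Proof.
  intros [t Ht] [s Hs]. exists (s + t). rewrite steps_add. congruence.
Qed.

Lemma leads_step c c' : leads (step c) c' -> leads c c'.
Proof. apply leads_trans. now exists 1. Qed.

Ltac step_simpl :=
  unfold step, frame;
  repeat (rewrite ?pfst_pair, ?psnd_pair, ?hd_lcons, ?tl_lcons);
  cbn [ite Nat.sub pred].

Lemma ite_lcons h t a b : ite (lcons h t) a b = b.
Proof. reflexivity. Qed.

Lemma enc_comp f gs : enc (Comp f gs) = cpair 3 (cpair (enc f) (encs gs 0)).
Proof. reflexivity. Qed.

Ltac one_step := apply leads_step; rewrite ?enc_comp; cbn [enc]; step_simpl;
  rewrite ?ite_lcons; cbn [ite].

Lemma step_eval c v y : eval c v y ->
  forall y0 K, leads (cpair y0 (lcons (cpair (enc c) (elist v)) K)) (cpair y K).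
Proof.
  (* The encoding is reversed, so the tail of an argument list is evaluated before its head. The
     invariant therefore leaves open the arguments [L] still to come and the values [acc] already
     collected; the last returned value [y1] is irrelevant there. *)
  revert c v y. refine (eval_induction _ (fun gs v ws => forall f L acc y0 K,
    exists y1, leads (cpair y0 (lcons (frame 6 f (encs gs L) (cpair (elist v) acc)) K))
      (cpair y1 (lcons (frame 6 f L (cpair (elist v) (fold_right lcons acc ws))) K)))
    _ _ _ _ _ _ _ _ _).
  - intros v y0 K. one_step. apply leads_refl.
  - intros x v y0 K. one_step. simpl elist. rewrite hd_lcons. apply leads_refl.
  - intros i v Hi y0 K. one_step. rewrite nth_elist by exact Hi. apply leads_refl.
  - intros f gs v ws y _ IHs IH y0 K. one_step.
    destruct (IHs (enc f) 0 0 y0 K) as [y1 H]. eapply leads_trans; [exact H|].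
    one_step. apply IH.
  - intros f g v y IH y0 K. one_step. simpl elist. rewrite hd_lcons, tl_lcons.
    cbn [ite]. apply IH.
  - intros f g n v r y IH1 IH2 y0 K. one_step. simpl elist. rewrite hd_lcons, tl_lcons.
    cbn [ite pred]. eapply leads_trans; [apply (IH1 y0)|].
    one_step. apply (IH2 r).
  - intros f v n IH0 IHm y0 K. one_step.
    assert (H : forall i m, i + m = n -> forall y1,
      leads (cpair y1 (lcons (cpair (enc f) (lcons m (elist v)))
                     (lcons (frame 9 (enc f) m (elist v)) K))) (cpair n K)).
    { induction i as [|i IHi]; intros m Hm y1.
      - replace m with n by lia. eapply leads_trans; [apply (IH0 y1)|].
        one_step. apply leads_refl.
      - destruct (IHm m) as [k Hk]; [lia|]. eapply leads_trans; [apply (Hk y1)|].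
        one_step. apply IHi. lia. }
    apply (H n 0). lia.
  - intros v f L acc y0 K. exists y0. apply leads_refl.
  - intros g gs v y ys IH IHs f L acc y0 K.
    destruct (IHs f (lcons (enc g) L) acc y0 K) as [y1 H]. exists y.
    eapply leads_trans; [exact H|]. one_step.
    eapply leads_trans; [apply IH|]. one_step. apply leads_refl.
Qed.

Definition start (n : nat) : nat := cpair 0 (lcons (cpair n (lcons n 0)) 0).

Lemma computable_step k A : computable k A -> computable k (fun v => step (A v)).
Proof.
  intros H. unfold step, frame. cbv zeta.
  repeat first [exact H | apply computable_sub | progress computability].
Qed.

Lemma least_zero (f : nat -> nat) t :
  f t = 0 -> exists m, f m = 0 /\ m <= t /\ forall i, i < m -> exists k, f i = S k.
Proof.
  revert f. induction t as [|t IH]; intros f Ht.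
  - exists 0. repeat split; auto; lia.
  - destruct (f 0) as [|k] eqn:E0.
    + exists 0. repeat split; auto; lia.
    + destruct (IH (fun i => f (S i)) Ht) as (m & Hm & Hle & Hlt).
      exists (S m). repeat split; [exact Hm | lia|].
      intros [|i] Hi; [eauto|]. apply Hlt. lia.
Qed.

(** Agreement at a single index, where [d] is defined, is all that diagonalisation uses. The index
    is the code of [d]. An empty stack is a fixed point of [step], so the first time at which the
    stack is empty, found by [Mu], shows the same value as the time given by the simulation. *)
Lemma universal_code : exists u, forall d, exists n, forall y,
  eval d [n] y -> eval u [n] y.
Proof.
  assert (Hs : computable 2 (fun v => steps (nth 0 v 0) (start (nth 1 v 0)))).
  { apply (computable_rec 2 (fun v => nth 0 v 0) (fun v => start (nth 1 v 0))
      (fun w => step (nth 1 w 0))).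
    - computability.
    - unfold start. computability.
    - apply computable_step. computability. }
  destruct (computable_pfst 2 _ Hs) as [cy Hy].
  destruct (computable_psnd 2 _ Hs) as [cK HK].
  exists (Comp cy [Mu cK; Proj 0]). intros d. exists (enc d). intros y Hd.
  set (n := enc d) in *.
  destruct (step_eval d [n] y Hd 0 0) as [t Ht]. fold n in Ht.
  change (steps t (start n) = cpair y 0) in Ht.
  destruct (least_zero (fun i => psnd (steps i (start n))) t) as (m & Hm & Hle & Hlt).
  { now rewrite Ht, psnd_pair. }
  assert (Hst : steps m (start n) = cpair y 0).
  { rewrite <- Ht. replace t with (t - m + m) by lia. rewrite steps_add.
    set (c := steps m (start n)) in *.
    generalize (t - m). intros i. induction i as [|i IH]; [reflexivity|].
    simpl. rewrite <- IH. unfold step. cbv zeta. now rewrite Hm. }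
  econstructor.
  - constructor; [|constructor; [apply (eProj 0 [n]); simpl; lia|constructor]].
    constructor.
    + specialize (HK [m; n] eq_refl). simpl in HK. rewrite Hst, psnd_pair in HK. exact HK.
    + intros i Hi. destruct (Hlt i Hi) as [k Hk]. exists k.
      specialize (HK [i; n] eq_refl). simpl in HK, Hk. now rewrite Hk in HK.
  - specialize (Hy [m; n] eq_refl). simpl in Hy. now rewrite Hst, pfst_pair in Hy.
Qed.

(** * Loop programs *)

(* [Loop i P] is: while register [i] is nonzero, decrement it and run [P]. *)
Inductive prog : Type :=
| Skip : prog
| Inc : nat -> prog
| Seq : prog -> prog -> prog
| Loop : nat -> prog -> prog.

Definition upd (s : nat -> nat) (i x : nat) : nat -> nat :=
  fun j => if j =? i then x else s j.

Inductive exec : prog -> (nat -> nat) -> (nat -> nat) -> Prop :=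
| exec_skip s : exec Skip s s
| exec_inc i s : exec (Inc i) s (upd s i (S (s i)))
| exec_seq P Q s s' s'' : exec P s s' -> exec Q s' s'' -> exec (Seq P Q) s s''
| exec_loop0 i P s : s i = 0 -> exec (Loop i P) s s
| exec_loopS i P s s' s'' n : s i = S n ->
    exec P (upd s i n) s' -> exec (Loop i P) s' s'' -> exec (Loop i P) s s''.

Ltac upd_tac :=
  unfold upd in *; intros;
  repeat match goal with
  | |- context [?a =? ?b] => destruct (Nat.eqb_spec a b)
  | |- context [?a <=? ?b] => destruct (Nat.leb_spec a b)
  | |- context [?a <? ?b] => destruct (Nat.ltb_spec a b)
  end; simpl; subst; try lia; try congruence.

Lemma exec_eq P s s1 s2 : exec P s s1 -> (forall j, s1 j = s2 j) -> exec P s s2.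
Proof. intros H E. now rewrite <- (functional_extensionality _ _ E). Qed.

Definition clear (i : nat) : prog := Loop i Skip.
Definition move (i j : nat) : prog := Loop i (Inc j).
Definition copy (i j t : nat) : prog := Seq (Loop i (Seq (Inc j) (Inc t))) (move t i).

Lemma exec_clear i s : exec (clear i) s (upd s i 0).
Proof.
  remember (s i) as n eqn:E. symmetry in E. revert s E.
  induction n as [|n IH]; intros s E.
  - eapply exec_eq; [now apply exec_loop0 | upd_tac].
  - eapply exec_loopS; [exact E | apply exec_skip|].
    eapply exec_eq; [apply IH; upd_tac | upd_tac].
Qed.

Lemma exec_move i j s : i <> j -> exec (move i j) s (upd (upd s j (s j + s i)) i 0).
Proof.
  intros Hij. remember (s i) as n eqn:E. symmetry in E. revert s E.
  induction n as [|n IH]; intros s E.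
  - eapply exec_eq; [now apply exec_loop0 | upd_tac].
  - eapply exec_loopS; [exact E | apply exec_inc|].
    eapply exec_eq; [apply IH; upd_tac | upd_tac].
Qed.

Lemma exec_copy i j t s : i <> j -> j <> t -> i <> t -> s t = 0 ->
  exec (copy i j t) s (upd s j (s j + s i)).
Proof.
  intros Hij Hjt Hit Ht.
  apply exec_seq with (upd (upd (upd s j (s j + s i)) t (s t + s i)) i 0).
  - clear Ht. remember (s i) as n eqn:E. symmetry in E. revert s E.
    induction n as [|n IH]; intros s E.
    + eapply exec_eq; [now apply exec_loop0 | upd_tac].
    + eapply exec_loopS; [exact E | eapply exec_seq; apply exec_inc|].
      eapply exec_eq; [apply IH; upd_tac | upd_tac].
  - eapply exec_eq; [apply exec_move; congruence | upd_tac].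
Qed.

(** * Compiling recursive functions to loop programs *)

Fixpoint copies (k i j t : nat) : prog :=
  match k with
  | 0 => Skip
  | S k => Seq (copy i j t) (copies k (S i) (S j) t)
  end.

Fixpoint clears (k i : nat) : prog :=
  match k with
  | 0 => Skip
  | S k => Seq (clear i) (clears k (S i))
  end.

Definition block (s : nat -> nat) (r : nat) (v : list nat) : nat -> nat :=
  fun j => if (r <=? j) && (j <? r + length v) then nth (j - r) v 0 else s j.

Definition args_at (s : nat -> nat) (b : nat) (v : list nat) : Prop :=
  forall j, j < length v -> s (b + j) = nth j v 0.

Definition zero_from (s : nat -> nat) (b : nat) : Prop := forall j, b <= j -> s j = 0.

Lemma block_cons s r x v : block s r (x :: v) = block (upd s r x) (S r) v.
Proof.
  extensionality j. unfold block, upd. simpl length.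
  destruct (Nat.eq_dec j r) as [->|Hj].
  - rewrite Nat.sub_diag. upd_tac.
  - destruct (Nat.leb_spec r j), (Nat.leb_spec (S r) j), (Nat.eqb_spec j r); try lia; simpl.
    + replace (j - r) with (S (j - S r)) by lia. simpl. upd_tac.
    + reflexivity.
Qed.

Lemma block_in s r v j : r <= j < r + length v -> block s r v j = nth (j - r) v 0.
Proof. intros H. unfold block. upd_tac. Qed.

Lemma block_out s r v j : j < r \/ r + length v <= j -> block s r v j = s j.
Proof. intros H. unfold block. upd_tac. Qed.

Lemma args_at_block s r v : args_at (block s r v) r v.
Proof. intros j Hj. rewrite block_in by lia. f_equal. lia. Qed.

Lemma args_at_cons s b x v : s b = x -> args_at s (S b) v -> args_at s b (x :: v).
Proof.
  intros Hx Hv [|j] Hj; simpl in *.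
  - now rewrite Nat.add_0_r.
  - rewrite Nat.add_succ_r. apply Hv. lia.
Qed.

Lemma args_at_ext s s' b v :
  (forall j, b <= j < b + length v -> s' j = s j) -> args_at s b v -> args_at s' b v.
Proof. intros E H j Hj. rewrite E by lia. now apply H. Qed.

Lemma exec_copies k : forall s i j v, k = length v -> args_at s i v ->
  i + length v <= j -> zero_from s j -> exec (copies k i j (j + k)) s (block s j v).
Proof.
  assert (H : forall v s i j t, args_at s i v -> i + length v <= j -> j + length v <= t ->
      zero_from s j -> exec (copies (length v) i j t) s (block s j v)).
  { induction v as [|x v IH]; intros s i j t Ha Hij Hjt Hz.
    - simpl. eapply exec_eq; [apply exec_skip|]. intros. rewrite block_out; simpl; auto; lia.
    - simpl in *. rewrite block_cons.
      assert (Hx : s i = x) by (specialize (Ha 0 ltac:(simpl; lia));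
        rewrite Nat.add_0_r in Ha; exact Ha).
      apply exec_seq with (upd s j x).
      + eapply exec_eq; [apply exec_copy; try lia; apply Hz; lia|].
        rewrite (Hz j), Hx by lia. reflexivity.
      + apply IH; try lia.
        * intros l Hl. unfold upd. destruct (Nat.eqb_spec (S i + l) j); [lia|].
          specialize (Ha (S l) ltac:(simpl; lia)). simpl in Ha. rewrite <- Ha. f_equal. lia.
        * intros l Hl. unfold upd. destruct (Nat.eqb_spec l j); [lia|]. apply Hz. lia. }
  intros s i j v -> Ha Hij Hz. apply H; auto.
Qed.

Lemma exec_clears k i s s' : (forall j, i <= j < i + k -> s' j = 0) ->
  (forall j, j < i \/ i + k <= j -> s' j = s j) -> exec (clears k i) s s'.
Proof.
  revert i s. induction k as [|k IH]; intros i s H0 Hs; simpl.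
  - eapply exec_eq; [apply exec_skip|]. intros j. symmetry. apply Hs. lia.
  - eapply exec_seq; [apply exec_clear|]. apply IH; intros j Hj.
    + apply H0. lia.
    + unfold upd. destruct (Nat.eqb_spec j i) as [->|]; [apply H0 | apply Hs]; lia.
Qed.

(* [compile f k b] reads [k] arguments in registers [b], ..., [b + k - 1],
   assumes that all later registers are 0, and changes only register [b + k]. *)
Fixpoint compile (c : code) (k b : nat) : prog :=
  let T := b + k in
  match c with
  | Zero => Skip
  | Succ => Seq (copy b T (S T)) (Inc T)
  | Proj i => copy (b + i) T (S T)
  | Comp f gs =>
      let m := length gs in
      Seq ((fix compiles gs r := match gs with
            | nil => Skip
            | g :: gs =>
                Seq (Seq (copies k b (S r) (S r + k))
                    (Seq (compile g k (S r))
                    (Seq (clears k (S r)) (move (S r + k) r))))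
                  (compiles gs (S r))
            end) gs (S T))
      (Seq (compile f m (S T)) (Seq (clears m (S T)) (move (S T + m) T)))
  | Prec f g =>
      let k' := pred k in
      let B := S T in
      Seq (copies k' (S b) (S (S B)) (S (S B) + k'))
      (Seq (compile f k' (S (S B)))
      (Seq (move (S (S B) + k') (S B))
      (Seq (copy b T (S (S B) + k'))
      (Seq (Loop T (Seq (compile g (S (S k')) B)
                   (Seq (clear (S B)) (Seq (move (S (S B) + k') (S B)) (Inc B)))))
      (Seq (clear B) (Seq (clears k' (S (S B))) (move (S B) T)))))))
  | Mu f =>
      let B := S T in
      Seq (copies k b (S B) (S B + k))
      (Seq (compile f (S k) B)
      (Seq (Loop (S B + k) (Seq (clear (S B + k)) (Seq (Inc B) (compile f (S k) B))))
      (Seq (clears k (S B)) (move B T))))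
  end.

Definition compiles (k b : nat) : list code -> nat -> prog :=
  fix compiles gs r := match gs with
  | nil => Skip
  | g :: gs =>
      Seq (Seq (copies k b (S r) (S r + k))
          (Seq (compile g k (S r))
          (Seq (clears k (S r)) (move (S r + k) r))))
        (compiles gs (S r))
  end.

(** The rule for [Prec] recurses downwards, but the compiled loop runs upwards from 0. Hence the
    case of [Prec] is stated with the whole sequence [rs] of intermediate values. *)
Lemma eval_induction_trace (P : code -> list nat -> nat -> Prop)
  (Q : list code -> list nat -> list nat -> Prop) :
  (forall v, P Zero v 0) ->
  (forall x v, P Succ (x :: v) (S x)) ->
  (forall i v, i < length v -> P (Proj i) v (nth i v 0)) ->
  (forall f gs v ws y, evals gs v ws -> Q gs v ws -> P f ws y -> P (Comp f gs) v y) ->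
  (forall f g n v rs, P f v (rs 0) ->
     (forall i, i < n -> P g (i :: rs i :: v) (rs (S i))) -> P (Prec f g) (n :: v) (rs n)) ->
  (forall f v n, P f (n :: v) 0 ->
     (forall m, m < n -> exists k, P f (m :: v) (S k)) -> P (Mu f) v n) ->
  (forall v, Q nil v nil) ->
  (forall g gs v y ys, P g v y -> Q gs v ys -> Q (g :: gs) v (y :: ys)) ->
  forall c v y, eval c v y -> P c v y.
Proof.
  intros H0 H1 H2 H3 H4 H5 H6 H7.
  assert (H : forall c v y, eval c v y -> P c v y /\
    forall f g n v', c = Prec f g -> v = n :: v' -> exists rs : nat -> nat,
      rs n = y /\ P f v' (rs 0) /\ forall i, i < n -> P g (i :: rs i :: v') (rs (S i))).
  2: { intros c v y Hc. now apply H. }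
  refine (eval_induction _ Q _ _ _ _ _ _ _ _ _); auto.
  - intros; split; [auto | discriminate].
  - intros; split; [auto | discriminate].
  - intros; split; [auto | discriminate].
  - intros f gs v ws y Hs HQ [IH _]; split; [eauto | discriminate].
  - intros f g v y [IH _]. split.
    + apply (H4 f g 0 v (fun _ => y)); [exact IH | lia].
    + intros f' g' n v' [= <- <-] [= <- <-]. exists (fun _ => y).
      repeat split; [exact IH | lia].
  - intros f g n v r y [_ IH1] [IH2 _].
    destruct (IH1 f g n v eq_refl eq_refl) as (rs & Hr & Hf & Hg).
    set (rs' := fun i => if i =? S n then y else rs i).
    assert (E1 : rs' (S n) = y) by (unfold rs'; now rewrite Nat.eqb_refl).
    assert (E2 : forall i, i <= n -> rs' i = rs i) by
      (intros i Hi; unfold rs'; destruct (Nat.eqb_spec i (S n)); [lia | reflexivity]).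
    assert (Hg' : forall i, i < S n -> P g (i :: rs' i :: v) (rs' (S i))).
    { intros i Hi. rewrite E2 by lia. destruct (Nat.eq_dec i n) as [->|].
      - now rewrite E1, Hr.
      - rewrite E2 by lia. apply Hg. lia. }
    assert (Hf' : P f v (rs' 0)) by (rewrite E2 by lia; exact Hf).
    split.
    + rewrite <- E1. now apply H4.
    + intros f' g' n' v' [= <- <-] [= <- <-]. exists rs'. auto.
  - intros f v n [IH _] Hm. split; [|discriminate]. apply H5; [exact IH|].
    intros m Hlt. destruct (Hm m Hlt) as [k [Hk _]]. eauto.
  - intros g gs v y ys [IH _] Hs. auto.
Qed.

Lemma evals_length gs v ws : evals gs v ws -> length ws = length gs.
Proof. induction 1; simpl; congruence. Qed.

Ltac reg_tac :=
  unfold zero_from in *; intros; unfold block, upd;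
  repeat match goal with
  | |- context [?a =? ?b] => destruct (Nat.eqb_spec a b); try lia
  | |- context [?a <=? ?b] => destruct (Nat.leb_spec a b); try lia
  | |- context [?a <? ?b] => destruct (Nat.ltb_spec a b); try lia
  end; simpl; subst; try lia; try congruence; auto with arith;
  repeat match goal with
  | H : forall j, _ <= j -> ?s j = 0 |- context [?s ?a] => rewrite (H a) by lia
  end; try lia.

Lemma exec_compile c v y : eval c v y ->
  forall b s, args_at s b v -> zero_from s (b + length v) ->
  exec (compile c (length v) b) s (upd s (b + length v) y).
Proof.
  revert c v y.
  refine (eval_induction_trace _ (fun gs v ws => forall b r s,
    args_at s b v -> b + length v < r -> zero_from s r ->
    exec (compiles (length v) b gs r) s (block s r ws))
    _ _ _ _ _ _ _ _).
  - intros v b s Ha Hz. simpl. eapply exec_eq; [apply exec_skip | reg_tac].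
  - intros x v b s Ha Hz. cbn [compile]. set (k := length (x :: v)) in *.
    assert (0 < k) by (subst k; simpl; lia).
    eapply exec_seq; [apply exec_copy; try lia; apply Hz; lia|].
    eapply exec_eq; [apply exec_inc|].
    specialize (Ha 0 ltac:(fold k; lia)). rewrite Nat.add_0_r in Ha. simpl in Ha.
    pose proof (Hz (b + k) ltac:(lia)). reg_tac.
  - intros i v Hi b s Ha Hz. cbn [compile].
    eapply exec_eq; [apply exec_copy; try lia; apply Hz; lia|].
    rewrite (Ha i Hi), (Hz (b + length v)) by lia. reflexivity.
  - intros f gs v ws y Hgs IHs IHf b s Ha Hz. cbn [compile].
    set (k := length v) in *. rewrite <- (evals_length _ _ _ Hgs). set (m := length ws) in *.
    fold (compiles k b).
    apply exec_seq with (block s (S (b + k)) ws).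
    { apply IHs; auto; try lia. intros j Hj. apply Hz. lia. }
    apply exec_seq with (upd (block s (S (b + k)) ws) (S (b + k) + m) y).
    { apply IHf; [apply args_at_block|]. fold m. reg_tac. }
    apply exec_seq with (upd s (S (b + k) + m) y).
    { apply exec_clears; reg_tac. }
    eapply exec_eq; [apply exec_move; lia | reg_tac].
  - intros f g n v rs IHf IHg b s Ha Hz. cbn [compile pred length] in *.
    set (k := length v) in *. set (T := b + S k) in *. set (R := S (S (S T))).
    assert (Hb : s b = n) by (specialize (Ha 0 ltac:(simpl; lia));
      rewrite Nat.add_0_r in Ha; exact Ha).
    assert (Hv : args_at s (S b) v).
    { intros j Hj. specialize (Ha (S j) ltac:(simpl; lia)). simpl in Ha.
      rewrite <- Ha. f_equal. lia. }
    (* Loop state: [c] rounds left in [T], then [i], the value [x] and the copy of [v] in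
       consecutive registers from [S T] on, which is exactly the argument block of [g]. *)
    set (L := fun c i x => upd (upd (upd (block s R v) (S (S T)) x) T c) (S T) i).
    apply exec_seq with (block s R v).
    { apply exec_copies; auto; [lia | reg_tac]. }
    apply exec_seq with (upd (block s R v) (R + k) (rs 0)).
    { apply IHf; [apply args_at_block | reg_tac]. }
    apply exec_seq with (L 0 0 (rs 0)).
    { eapply exec_eq; [apply exec_move; lia | unfold L; reg_tac]. }
    apply exec_seq with (L n 0 (rs 0)).
    { eapply exec_eq; [apply exec_copy; try lia; unfold L; reg_tac | unfold L; reg_tac]. }
    apply exec_seq with (L 0 n (rs n)).
    { assert (H : forall c i, c + i = n -> exec (Loop T (Seq (compile g (S (S k)) (S T))
        (Seq (clear (S (S T))) (Seq (move (R + k) (S (S T))) (Inc (S T))))))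
        (L c i (rs i)) (L 0 n (rs n))).
      { induction c as [|c IHc]; intros i Hi.
        - replace n with i by lia. apply exec_loop0. unfold L. reg_tac.
        - apply exec_loopS with (s' := L c (S i) (rs (S i))) (n := c);
            [unfold L; reg_tac | | apply IHc; lia].
          apply exec_seq with (upd (L c i (rs i)) (R + k) (rs (S i))).
          { replace (upd (L (S c) i (rs i)) T c) with (L c i (rs i)) by
              (extensionality j; unfold L; reg_tac).
            specialize (IHg i ltac:(lia) (S T) (L c i (rs i))). cbn [length] in IHg.
            fold k in IHg. replace (S T + S (S k)) with (R + k) in IHg by (unfold R; lia).
            apply IHg.
            - apply args_at_cons; [unfold L; reg_tac|].
              apply args_at_cons; [unfold L; reg_tac|].
              apply args_at_ext with (block s R v); [unfold L; reg_tac|].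
              apply args_at_block.
            - unfold L; reg_tac. }
          apply exec_seq with (upd (L c i 0) (R + k) (rs (S i))).
          { eapply exec_eq; [apply exec_clear | unfold L; reg_tac]. }
          apply exec_seq with (L c i (rs (S i))).
          { eapply exec_eq; [apply exec_move; lia | unfold L; reg_tac]. }
          eapply exec_eq; [apply exec_inc | unfold L; reg_tac]. }
      apply H. lia. }
    apply exec_seq with (L 0 0 (rs n)).
    { eapply exec_eq; [apply exec_clear | unfold L; reg_tac]. }
    apply exec_seq with (upd s (S (S T)) (rs n)).
    { apply exec_clears; unfold L; reg_tac. }
    eapply exec_eq; [apply exec_move; lia | reg_tac].
  - intros f v n IH0 IHm b s Ha Hz. cbn [compile].
    set (k := length v) in *. set (T := b + k) in *. set (R := S (S T)).
    (* Search state: the candidate [m] in [S T], followed by the copy of [v], with the value [x] of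
       [f] at this candidate in [R + k]. *)
    set (L := fun m x => upd (upd (block s R v) (R + k) x) (S T) m).
    assert (Hf : forall m x, (forall b s, args_at s b (m :: v) ->
        zero_from s (b + length (m :: v)) ->
        exec (compile f (length (m :: v)) b) s (upd s (b + length (m :: v)) x)) ->
      exec (compile f (S k) (S T)) (L m 0) (L m x)).
    { intros m x H. specialize (H (S T) (L m 0)). cbn [length] in H. fold k in H.
      eapply exec_eq; [apply H | unfold L; reg_tac].
      - apply args_at_cons; [unfold L; reg_tac|].
        apply args_at_ext with (block s R v); [unfold L; reg_tac|].
        apply args_at_block.
      - unfold L; reg_tac. }
    assert (Hx : forall m, m <= n -> exists x, exec (compile f (S k) (S T)) (L m 0) (L m x)
               /\ (x = 0 <-> m = n)).
    { intros m Hm. destruct (Nat.eq_dec m n) as [->|Hn].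
      - exists 0. split; [apply Hf, IH0 | tauto].
      - destruct (IHm m ltac:(lia)) as [x Hx]. exists (S x). split; [apply Hf, Hx | lia]. }
    apply exec_seq with (L 0 0).
    { eapply exec_eq; [apply (exec_copies k s b R v); auto; [lia | reg_tac]|].
      unfold L; reg_tac. }
    destruct (Hx 0 ltac:(lia)) as (x & Hrun & Hx0).
    apply exec_seq with (L 0 x); [exact Hrun|].
    apply exec_seq with (L n 0).
    { assert (H : forall i m x, i + m = n -> (x = 0 <-> m = n) ->
        exec (Loop (R + k) (Seq (clear (R + k)) (Seq (Inc (S T)) (compile f (S k) (S T)))))
          (L m x) (L n 0)).
      { clear x Hrun Hx0. induction i as [|i IHi]; intros m x Hi Hx0.
        - replace x with 0 by lia. replace m with n by lia.
          apply exec_loop0. unfold L; reg_tac.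
        - destruct x as [|x]; [lia|].
          destruct (Hx (S m) ltac:(lia)) as (x' & Hrun & Hx').
          apply exec_loopS with (s' := L (S m) x') (n := x);
            [unfold L; reg_tac | | apply IHi; lia].
          apply exec_seq with (L m 0).
          { eapply exec_eq; [apply exec_clear | unfold L; reg_tac]. }
          apply exec_seq with (L (S m) 0); [|exact Hrun].
          eapply exec_eq; [apply exec_inc | unfold L; reg_tac]. }
      apply (H n); lia. }
    apply exec_seq with (upd s (S T) n).
    { apply exec_clears; unfold L; reg_tac. }
    eapply exec_eq; [apply exec_move; lia | reg_tac].
  - intros v b r s _ _ _. simpl. eapply exec_eq; [apply exec_skip|].
    intros j. rewrite block_out; simpl; auto; lia.
  - intros g gs v y ys IH IHs b r s Ha Hr Hz. cbn [compiles]. rewrite block_cons.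
    set (k := length v) in *.
    apply exec_seq with (upd s r y).
    + apply exec_seq with (block s (S r) v).
      { apply exec_copies; auto; [lia | reg_tac]. }
      apply exec_seq with (upd (block s (S r) v) (S r + k) y).
      { apply IH; [apply args_at_block | fold k; reg_tac]. }
      apply exec_seq with (upd s (S r + k) y).
      { apply exec_clears; reg_tac. }
      eapply exec_eq; [apply exec_move; lia | reg_tac].
    + apply IHs; [|lia|reg_tac].
      apply args_at_ext with s; [reg_tac | exact Ha].
Qed.

(** * Division machines *)

(* [(d, p, q1, q2)] is: if [d] divides the number [n], replace [n] by
   [p * (n / d)] and go to [q1], else go to [q2]. *)
Definition instr : Type := nat * nat * nat * nat.

Inductive mstep (M : list instr) : nat * nat -> nat * nat -> Prop :=
| mstep_div q d p q1 q2 m : nth_error M q = Some (d, p, q1, q2) ->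
    mstep M (q, d * m) (q1, p * m)
| mstep_ndiv q d p q1 q2 n : nth_error M q = Some (d, p, q1, q2) ->
    (forall m, n <> d * m) -> mstep M (q, n) (q2, n).

Inductive msteps (M : list instr) : nat * nat -> nat * nat -> Prop :=
| msteps_refl c : msteps M c c
| msteps_cons c c' c'' : mstep M c c' -> msteps M c' c'' -> msteps M c c''.

Lemma msteps_trans M c c' c'' : msteps M c c' -> msteps M c' c'' -> msteps M c c''.
Proof. induction 1; intros; auto. econstructor; eauto. Qed.

Lemma msteps_one M c c' : mstep M c c' -> msteps M c c'.
Proof. intros H. econstructor; [exact H | constructor]. Qed.

Definition divisors_pos (M : list instr) : Prop :=
  forall q d p q1 q2, nth_error M q = Some (d, p, q1, q2) -> 0 < d.

Lemma mstep_det M c c1 c2 : divisors_pos M -> mstep M c c1 -> mstep M c c2 -> c1 = c2.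
Proof.
  intros HM H1 H2.
  inversion H1 as [q d p q1 q2 m E | q d p q1 q2 n E N]; subst;
  inversion H2 as [q' d' p' q1' q2' m' E' Hm | q' d' p' q1' q2' n' E' N' Hm]; subst;
  rewrite E in E'; injection E' as <- <- <- <-; auto.
  - apply HM in E. f_equal. f_equal. nia.
  - now destruct (N' m).
  - now destruct (N m').
Qed.

Lemma msteps_final_det M c c1 c2 : divisors_pos M -> msteps M c c1 -> msteps M c c2 ->
  nth_error M (fst c1) = None -> nth_error M (fst c2) = None -> c1 = c2.
Proof.
  assert (stuck : forall c c', mstep M c c' -> nth_error M (fst c) = None -> False).
  { intros a b H HN. destruct H as [q d p q1 q2 m E | q d p q1 q2 n E N]; simpl in HN; congruence. }
  intros HM H1. revert c2. induction H1 as [c|c c' c1 Hs _ IH]; intros c2 H2 N1 N2.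
  - destruct H2; [reflexivity|]. exfalso; eauto.
  - destruct H2 as [c|c d c2 Hd H2]; [exfalso; eauto|].
    assert (c' = d) as -> by eauto using mstep_det. auto.
Qed.

(** * Registers as exponents of one number *)

(* Sylvester's sequence: each [base k] is one more than the product of the
   previous ones, which makes the sequence pairwise coprime. *)
Fixpoint base_prod (k : nat) : nat :=
  match k with 0 => 1 | S k => base_prod k * S (base_prod k) end.
Definition base (k : nat) : nat := S (base_prod k).
Arguments base : simpl never.

Lemma base_gt1 k : 1 < base k.
Proof.
  unfold base. assert (0 < base_prod k); [|lia]. induction k; simpl; nia.
Qed.

Lemma base_divide i k : i < k -> Nat.divide (base i) (base_prod k).
Proof.
  induction 1 as [|k _ IH]; simpl.
  - exists (base_prod i). reflexivity.
  - now apply Nat.divide_mul_l.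
Qed.

(** For i < k a common divisor divides both [base_prod k] and its successor. *)
Lemma base_coprime i k : i <> k -> Nat.gcd (base i) (base k) = 1.
Proof.
  assert (H : forall i k, i < k -> Nat.gcd (base i) (base k) = 1).
  { clear. intros i k H. apply base_divide in H.
    apply Nat.divide_1_r.
    apply (Nat.divide_add_cancel_r _ (base_prod k)).
    - eapply Nat.divide_trans; [apply Nat.gcd_divide_l | exact H].
    - rewrite Nat.add_1_r. apply Nat.gcd_divide_r. }
  intros Hik. destruct (Nat.lt_trichotomy i k) as [|[|]]; [auto | lia|].
  rewrite Nat.gcd_comm. auto.
Qed.

Fixpoint godel (K : nat) (s : nat -> nat) : nat :=
  match K with 0 => 1 | S K => godel K s * base K ^ s K end.

Definition represents (s : nat -> nat) (n : nat) : Prop :=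
  exists K, zero_from s K /\ n = godel K s.

Lemma godel_extend K j s : zero_from s K -> godel (K + j) s = godel K s.
Proof.
  intros H. induction j as [|j IH]; [now rewrite Nat.add_0_r|].
  rewrite Nat.add_succ_r. simpl. rewrite (H (K + j)) by lia. simpl. lia.
Qed.

Lemma represents_above s n i : represents s n ->
  exists K, i < K /\ zero_from s K /\ n = godel K s.
Proof.
  intros (K & HK & ->). exists (K + S i). repeat split; [lia | | now rewrite godel_extend].
  intros j Hj. apply HK. lia.
Qed.

Lemma godel_ext K s s' : (forall j, j < K -> s j = s' j) -> godel K s = godel K s'.
Proof.
  induction K as [|K IH]; intros H; [reflexivity|]. simpl.
  rewrite IH by (intros; apply H; lia). now rewrite H by lia.
Qed.

Lemma godel_inc K s i : i < K -> godel K (upd s i (S (s i))) = base i * godel K s.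
Proof.
  induction K as [|K IH]; intros Hi; [lia|]. cbn [godel].
  destruct (Nat.eq_dec i K) as [->|Hn].
  - rewrite (godel_ext K _ s) by upd_tac.
    unfold upd. rewrite Nat.eqb_refl, Nat.pow_succ_r'. ring.
  - rewrite IH by lia. unfold upd. destruct (Nat.eqb_spec K i); [lia | ring].
Qed.

Lemma represents_inc s n i : represents s n ->
  represents (upd s i (S (s i))) (base i * n).
Proof.
  intros H. destruct (represents_above s n i H) as (K & Hi & HK & ->).
  exists K. split; [|now rewrite godel_inc].
  intros j Hj. specialize (HK j Hj). upd_tac.
Qed.

Lemma represents_dec s n i x : represents s n -> s i = S x ->
  exists n', n = base i * n' /\ represents (upd s i x) n'.
Proof.
  intros H Hx. destruct (represents_above s n i H) as (K & Hi & HK & ->).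
  exists (godel K (upd s i x)). split.
  - rewrite <- godel_inc by exact Hi. apply godel_ext. upd_tac.
  - exists K. split; [|reflexivity]. intros j Hj. specialize (HK j Hj). upd_tac.
Qed.

Lemma gcd_1_r a : Nat.gcd a 1 = 1.
Proof. apply Nat.divide_1_r, Nat.gcd_divide_r. Qed.

Lemma coprime_mul a b c : Nat.gcd a b = 1 -> Nat.gcd a c = 1 -> Nat.gcd a (b * c) = 1.
Proof.
  intros Hb Hc. set (g := Nat.gcd a (b * c)).
  assert (Ha : Nat.divide g a) by apply Nat.gcd_divide_l.
  assert (Hg : Nat.gcd g b = 1).
  { apply Nat.divide_1_r. rewrite <- Hb. apply Nat.gcd_greatest.
    - eapply Nat.divide_trans; [apply Nat.gcd_divide_l | exact Ha].
    - apply Nat.gcd_divide_r. }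
  apply Nat.divide_1_r. rewrite <- Hc. apply Nat.gcd_greatest; [exact Ha|].
  apply (Nat.gauss _ b); [apply Nat.gcd_divide_r | exact Hg].
Qed.

(** All other bases are coprime to [base i], hence so is the product of their powers. This is what
    makes a divisibility test a zero test. *)
Lemma represents_zero s n i : represents s n -> s i = 0 -> forall m, n <> base i * m.
Proof.
  intros (K & _ & ->) H0 m Hm.
  assert (Hg : Nat.gcd (base i) (godel K s) = 1).
  { clear Hm. induction K as [|K IH]; cbn [godel]; [apply gcd_1_r|].
    apply coprime_mul; [exact IH|].
    destruct (Nat.eq_dec i K) as [->|Hn]; [rewrite H0; apply gcd_1_r|].
    induction (s K) as [|e IHe]; cbn [Nat.pow]; [apply gcd_1_r|].
    apply coprime_mul; [now apply base_coprime | exact IHe]. }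
  rewrite Hm in Hg. pose proof (base_gt1 i).
  assert (Nat.divide (base i) 1); [|now apply Nat.divide_1_r in H1; lia].
  rewrite <- Hg. apply Nat.gcd_greatest; [apply Nat.divide_refl|].
  apply Nat.divide_mul_l, Nat.divide_refl.
Qed.

(** [a] is the address of the first instruction. Divisor 1 always succeeds, so the failure target 0
    in increments and backward jumps is never taken. *)
Fixpoint flat (P : prog) (a : nat) : list instr :=
  match P with
  | Skip => nil
  | Inc i => [(1, base i, S a, 0)]
  | Seq P Q => flat P a ++ flat Q (a + length (flat P a))
  | Loop i P =>
      let c := flat P (S a) in
      (base i, 1, S a, S (S a + length c)) :: c ++ [(1, 1, a, 0)]
  end.

Lemma nth_error_middle {A} (l l' : list A) x : nth_error (l ++ x :: l') (length l) = Some x.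
Proof. rewrite nth_error_app2, Nat.sub_diag by lia. reflexivity. Qed.

Lemma flat_correct P s s' : exec P s s' -> forall pre post n, represents s n ->
  exists n', represents s' n' /\
    msteps (pre ++ flat P (length pre) ++ post)
      (length pre, n) (length pre + length (flat P (length pre)), n').
Proof.
  induction 1 as [s | i s | P Q s s' s'' _ IHP _ IHQ | i P s H0 | i P s s' s'' x Hx _ IHP _ IHL];
    intros pre post n Hn.
  - exists n. split; [exact Hn|]. simpl. rewrite Nat.add_0_r. constructor.
  - exists (base i * n). split; [now apply represents_inc|]. cbn [flat length app].
    rewrite Nat.add_1_r. apply msteps_one.
    replace n with (1 * n) at 1 by lia. eapply mstep_div, nth_error_middle.
  - set (a := length pre).
    destruct (IHP pre (flat Q (a + length (flat P a)) ++ post) n Hn) as (n1 & Hn1 & S1).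
    destruct (IHQ (pre ++ flat P a) post n1 Hn1) as (n2 & Hn2 & S2).
    exists n2. split; [exact Hn2|]. fold a in S1. rewrite length_app in S2. fold a in S2.
    cbn [flat]. rewrite <- !app_assoc in *. rewrite length_app, Nat.add_assoc.
    eapply msteps_trans; eauto.
  - exists n. split; [exact Hn|]. cbn [flat]. apply msteps_one.
    set (c := flat P (S (length pre))).
    replace (length pre + _) with (S (S (length pre) + length c)) by
      (simpl; rewrite length_app; simpl; lia).
    eapply mstep_ndiv; [apply nth_error_middle|]. eapply represents_zero; eauto.
  - destruct (represents_dec s n i x Hn Hx) as (n0 & -> & Hn0).
    cbn [flat]. set (a := length pre). set (c := flat P (S a)).
    set (hd := (base i, 1, S a, S (S a + length c))).
    destruct (IHP (pre ++ [hd]) ([(1, 1, a, 0)] ++ post) n0 Hn0) as (n1 & Hn1 & S1).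
    destruct (IHL pre post n1 Hn1) as (n2 & Hn2 & S2). cbn [flat] in S2.
    exists n2. split; [exact Hn2|]. fold a c hd in S2.
    rewrite length_app, Nat.add_1_r in S1. fold a c in S1.
    match type of S2 with msteps ?m _ _ => set (M := m) in * end.
    assert (EM : M = (pre ++ [hd]) ++ c ++ [(1, 1, a, 0)] ++ post) by
      (unfold M; rewrite <- !app_assoc; simpl; now rewrite <- app_assoc).
    assert (S1' : msteps M (S a, n0) (S a + length c, n1)) by (rewrite EM; exact S1).
    eapply msteps_cons; [|eapply msteps_trans; [exact S1'|]].
    + replace n0 with (1 * n0) at 2 by lia. eapply mstep_div.
      apply nth_error_middle.
    + eapply msteps_cons; [|exact S2].
      replace n1 with (1 * n1) by lia.
      eapply mstep_div. rewrite EM, app_assoc.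
      replace (S a + length c) with (length ((pre ++ [hd]) ++ c)) by
        (rewrite !length_app; simpl; fold a; lia).
      apply nth_error_middle.
Qed.

Lemma flat_divisors P : forall a d p q1 q2, In (d, p, q1, q2) (flat P a) -> 0 < d.
Proof.
  induction P as [| i | P IHP Q IHQ | i P IH]; intros a d p q1 q2; simpl.
  - tauto.
  - intros [[= <- _ _ _]|[]]. lia.
  - rewrite in_app_iff. intros [H|H]; eauto.
  - rewrite in_app_iff. pose proof (base_gt1 i).
    intros [[= <- _ _ _]|[H'|[[= <- _ _ _]|[]]]]; [lia | eauto | lia].
Qed.

Lemma code_machine u : exists M acc, divisors_pos M /\
  forall n y, eval u [n] y -> (exists m, msteps M (0, 2 ^ n) (acc, m)) <-> y <> 0.
Proof.
  set (F := flat (compile u 1 0) 0). set (L := length F).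
  (* Register 1 holds the output of [u]. The added test leaves the program at [S L] if it is nonzero
     and at [S (S L)] otherwise, so acceptance becomes a halting address. *)
  set (M := F ++ [(base 1, 1, S L, S (S L))]).
  assert (HL : length M = S L) by (unfold M; rewrite length_app; simpl; lia).
  assert (HM : divisors_pos M).
  { intros q d p q1 q2 H. apply nth_error_In in H. unfold M in H.
    rewrite in_app_iff in H. destruct H as [H|[[= <- _ _ _]|[]]].
    - eapply flat_divisors, H.
    - pose proof (base_gt1 1). lia. }
  exists M, (S L). split; [exact HM|].
  assert (HN : forall a, S L <= a -> nth_error M a = None) by
    (intros; apply nth_error_None; lia).
  intros n y Hy.
  set (s := upd (fun _ => 0) 0 n).
  (* The input n sits in register 0, whose base is 2. *)
  assert (Hn : represents s (2 ^ n)).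
  { exists 1. split; [unfold s; intros j Hj; upd_tac|].
    simpl. unfold s. change (base 0) with 2. unfold upd. simpl. lia. }
  assert (Hrun : exec (compile u 1 0) s (upd s 1 y)).
  { apply (exec_compile u [n] y Hy 0).
    - intros [|j] Hj; simpl in *; [reflexivity | lia].
    - unfold s. intros j Hj. simpl in Hj. upd_tac. }
  destruct (flat_correct _ _ _ Hrun [] [(base 1, 1, S L, S (S L))] (2 ^ n) Hn)
    as (n' & Hn' & Hst).
  simpl in Hst. fold F L M in Hst.
  assert (Hat : nth_error M L = Some (base 1, 1, S L, S (S L))) by apply nth_error_middle.
  destruct (Nat.eq_dec y 0) as [->|Hy0].
  - split; [|congruence]. intros [m Hm] _.
    (* Both addresses lie outside [M], so determinism identifies the two halting configurations,
       which is absurd. *)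
    assert (H : (S L, m) = (S (S L), n')); [|injection H; lia].
    eapply msteps_final_det; [exact HM | exact Hm | | apply HN; simpl; lia
      | apply HN; simpl; lia].
    eapply msteps_trans; [exact Hst|]. apply msteps_one.
    eapply mstep_ndiv; [exact Hat|]. eapply represents_zero; [exact Hn' | upd_tac].
  - split; [auto|]. intros _. destruct y as [|x]; [lia|].
    destruct (represents_dec _ _ 1 x Hn' ltac:(upd_tac)) as (n1 & -> & _).
    exists (1 * n1). eapply msteps_trans; [exact Hst|]. apply msteps_one.
    eapply mstep_div, Hat.
Qed.

(** * Generators realised by chains of tiles *)

Local Open Scope Z_scope.

(** * Tiling sums under linear functionals *)

Definition lin {A} (phi : A -> Z) (l : list (A * Z)) : Z :=
  fold_right (fun '(a, z) acc => z * phi a + acc) 0 l.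

Lemma lin_app {A} (phi : A -> Z) l l' : lin phi (l ++ l') = lin phi l + lin phi l'.
Proof. induction l as [|[a z] l IH]; simpl; lia. Qed.

Definition delta {A} (dec : forall a b : A, {a = b} + {a <> b}) (a b : A) : Z :=
  if dec a b then 1 else 0.

Lemma lin_split {A} (dec : forall a b : A, {a = b} + {a <> b}) (phi : A -> Z) a l :
  lin phi l = phi a * lin (delta dec a) l +
    lin phi (filter (fun '(b, _) => if dec a b then false else true) l).
Proof.
  unfold delta. induction l as [|[b z] l IH]; simpl; [lia|].
  rewrite IH. destruct (dec a b) as [->|]; simpl; lia.
Qed.

(** Places are eliminated one at a time, each with total coefficient 0. This converts an equation
    known edge by edge into one that holds under every potential. *)
Lemma lin_zero {A} (dec : forall a b : A, {a = b} + {a <> b}) l :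
  (forall a, In a (map fst l) -> lin (delta dec a) l = 0) -> forall phi, lin phi l = 0.
Proof.
  remember (length l) as n eqn:En. assert (Hn : (length l <= n)%nat) by lia. clear En.
  revert l Hn. induction n as [|n IH]; intros l Hn H phi.
  - destruct l; [reflexivity | simpl in Hn; lia].
  - destruct l as [|[a z] l]; [reflexivity|].
    rewrite (lin_split dec phi a), H by (now left). rewrite Z.mul_0_r. apply IH.
    + simpl in *. destruct (dec a a); [|easy].
      eapply Nat.le_trans; [apply filter_length_le | lia].
    + intros b Hb. apply in_map_iff in Hb. destruct Hb as ([b' z'] & Hb & Hin).
      simpl in Hb. subst b'. apply filter_In in Hin. destruct Hin as [Hin Hab].
      specialize (H b (in_map fst _ _ Hin)). rewrite (lin_split dec (delta dec b) a) in H.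
      unfold delta at 1 in H. destruct (dec b a) as [->|_]; [|lia].
      now destruct (dec a a).
Qed.

(* [(true, x, y, c)] is colour [c] on the horizontal edge from [(x, y)] to
   [(x + 1, y)], and [(false, x, y, c)] on the vertical edge from [(x, y)] to
   [(x, y + 1)]. *)
Definition place : Type := bool * Z * Z * nat.

Definition place_dec (a b : place) : {a = b} + {a <> b}.
Proof. repeat decide equality. Defined.

Definition tile_terms (x y : Z) (t : tile) : list (place * Z) :=
  match t with (cN, cE, cS, cW) =>
    [((true, x, y + 1, cN), nd 0 cN); ((false, x + 1, y, cE), nd 0 cE);
     ((true, x, y, cS), - nd 0 cS); ((false, x, y, cW), - nd 0 cW)]
  end.

Definition tile_val (phi : place -> Z) (x y : Z) (t : tile) : Z := lin phi (tile_terms x y t).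

Definition sum_val (phi : place -> Z) (L : list (Z * Z * tile)) : Z :=
  lin phi (flat_map (fun '(x, y, t) => tile_terms x y t) L).

Lemma sum_val_cons phi x y t L : sum_val phi ((x, y, t) :: L) = tile_val phi x y t + sum_val phi L.
Proof. unfold sum_val. simpl flat_map. now rewrite lin_app. Qed.

Lemma sum_val_app phi L L' : sum_val phi (L ++ L') = sum_val phi L + sum_val phi L'.
Proof. unfold sum_val. now rewrite flat_map_app, lin_app. Qed.

Lemma sum_val_nonneg phi L :
  (forall x y t, In (x, y, t) L -> 0 <= tile_val phi x y t) -> 0 <= sum_val phi L.
Proof.
  induction L as [|[[x y] t] L IH]; intros H; [reflexivity|].
  rewrite sum_val_cons. pose proof (H x y t (or_introl eq_refl)).
  enough (0 <= sum_val phi L) by lia. apply IH. intros; apply H; now right.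
Qed.

Definition edge_end (h : bool) (x y : Z) : point := if h then (x + 1, y) else (x, y + 1).

Lemma same_edge_sym u v a b : same_edge u v a b = same_edge v u a b.
Proof. unfold same_edge. rewrite orb_comm. f_equal; apply andb_comm. Qed.

Lemma same_edge_canonical h x y h' x' y' :
  same_edge (x, y) (edge_end h x y) (x', y') (edge_end h' x' y') =
  if bool_dec h h' then (x =? x') && (y =? y') else false.
Proof.
  unfold same_edge, pt_eqb, edge_end.
  destruct h, h'; cbn [fst snd bool_dec bool_rec bool_rect];
    destruct (Z.eqb_spec x x'), (Z.eqb_spec y y'); subst;
    repeat match goal with |- context [?a =? ?b] => destruct (Z.eqb_spec a b) end;
    simpl; try reflexivity; lia.
Qed.

Lemma same_edge_canonical_sym h x y h' x' y' :
  same_edge (x, y) (edge_end h x y) (edge_end h' x' y') (x', y') =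
  if bool_dec h h' then (x =? x') && (y =? y') else false.
Proof.
  rewrite <- same_edge_canonical. unfold same_edge. now rewrite orb_comm.
Qed.

Lemma delta_place h X Y C h' x y c :
  delta place_dec (h, X, Y, C) (h', x, y, c) =
  if bool_dec h h' then (if (X =? x) && (Y =? y) then at_color C c 1 else 0) else 0.
Proof.
  unfold delta, at_color. destruct (place_dec _ _) as [[= -> -> -> ->]|N].
  - destruct (bool_dec h' h'); [|easy]. now rewrite !Z.eqb_refl, Nat.eqb_refl.
  - destruct (bool_dec h h') as [->|]; [|reflexivity].
    destruct (Z.eqb_spec X x) as [->|]; [|reflexivity].
    destruct (Z.eqb_spec Y y) as [->|]; [|reflexivity]. simpl.
    destruct (Nat.eqb_spec C c) as [->|]; [now destruct N | reflexivity].
Qed.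

Lemma at_color_mul C c z : at_color C c z = z * at_color C c 1.
Proof. unfold at_color. destruct (Nat.eqb C c); lia. Qed.

Lemma tile_map_delta h X Y C x y t :
  translate x y (tile_map 0 t) (X, Y) (edge_end h X Y) C =
  tile_val (delta place_dec (h, X, Y, C)) x y t.
Proof.
  destruct t as [[[cN cE] cS] cW]. unfold translate, tile_map, tile_val, tile_terms.
  cbn [lin fold_right]. rewrite !delta_place.
  assert (E : (fst (edge_end h X Y) - x, snd (edge_end h X Y) - y) =
              edge_end h (X - x) (Y - y)) by
    (destruct h; simpl; f_equal; lia).
  rewrite E. cbn [fst snd].
  change (1, 0) with (edge_end true 0 0) at 1.
  change (1, 1) with (edge_end false 1 0) at 1.
  change (1, 1) with (edge_end true 0 1) at 1.
  change (same_edge (X - x, Y - y) (edge_end h (X - x) (Y - y)) (0, 1) (0, 0)) with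
    (same_edge (X - x, Y - y) (edge_end h (X - x) (Y - y)) (edge_end false 0 0) (0, 0)).
  rewrite !same_edge_canonical, !same_edge_canonical_sym.
  rewrite (at_color_mul C cN (nd 0 cN)), (at_color_mul C cE (nd 0 cE)),
    (at_color_mul C cS (- nd 0 cS)), (at_color_mul C cW (- nd 0 cW)).
  assert (H : forall a b, (a - b =? 0) = (a =? b)) by
    (intros; destruct (Z.eqb_spec (a - b) 0), (Z.eqb_spec a b); lia).
  assert (H1 : forall a b, (a - b =? 1) = (a =? b + 1)) by
    (intros; destruct (Z.eqb_spec (a - b) 1), (Z.eqb_spec a (b + 1)); lia).
  rewrite !H, !H1.
  destruct (bool_dec h true), (bool_dec h false); subst; try discriminate;
    repeat match goal with |- context [if ?b then _ else _] => destruct b end; lia.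
Qed.

Lemma tiling_sum_delta h X Y C L :
  tiling_sum 0 L (X, Y) (edge_end h X Y) C = sum_val (delta place_dec (h, X, Y, C)) L.
Proof.
  unfold tiling_sum. induction L as [|[[x y] t] L IH]; [reflexivity|].
  rewrite sum_val_cons, <- IH, <- tile_map_delta. reflexivity.
Qed.

Lemma tiling_sum_sym L u v c : tiling_sum 0 L u v c = tiling_sum 0 L v u c.
Proof.
  unfold tiling_sum. induction L as [|[[x y] t] L IH]; [reflexivity|]. cbn [fold_right].
  rewrite IH. f_equal. unfold translate, tile_map. destruct t as [[[cN cE] cS] cW].
  rewrite !(same_edge_sym (fst u - x, snd u - y)). reflexivity.
Qed.

Lemma adjacent_cases u v : adjacent u v ->
  exists h x y, (u = (x, y) /\ v = edge_end h x y) \/ (v = (x, y) /\ u = edge_end h x y).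
Proof.
  destruct u as [a b], v as [c d]. unfold adjacent. simpl. intros H.
  assert (Hc : (b = d /\ (c = a + 1 \/ a = c + 1)) \/ (a = c /\ (d = b + 1 \/ b = d + 1))) by lia.
  destruct Hc as [[-> [-> | ->]]|[-> [-> | ->]]].
  - exists true, a, d. auto.
  - exists true, c, d. auto.
  - exists false, c, b. auto.
  - exists false, c, d. auto.
Qed.

Lemma edge_end_adjacent h x y : adjacent (x, y) (edge_end h x y).
Proof. unfold adjacent. destruct h; simpl; lia. Qed.

(* A token [(x, y, c)] is a unit of colour [c] on the horizontal edge at [(x, y)]. *)
Definition tokens : Type := list (Z * Z * nat).

Definition token_terms (F : tokens) : list (place * Z) :=
  map (fun '(x, y, c) => ((true, x, y, c), nd 0 c)) F.

Definition tokens_val (phi : place -> Z) (F : tokens) : Z := lin phi (token_terms F).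

Definition represents_tokens (f : emap) (F : tokens) : Prop :=
  (forall u v c, f u v c = f v u c) /\
  forall h X Y C, f (X, Y) (edge_end h X Y) C = tokens_val (delta place_dec (h, X, Y, C)) F.

Lemma zero_sum_val k T f F L :
  represents_tokens f F -> (forall t, In t T -> tile_ok k t) ->
  (forall x y c, In (x, y, c) F -> (c < k)%nat) ->
  (forall x y t, In (x, y, t) L -> In t T) ->
  (forall u v, adjacent u v -> forall c, (c < k)%nat -> f u v c + tiling_sum 0 L u v c = 0) ->
  forall phi, tokens_val phi F + sum_val phi L = 0.
Proof.
  intros [_ Hf] HT HF HL H phi. unfold tokens_val, sum_val. rewrite <- lin_app.
  apply (lin_zero place_dec). intros [[[h X] Y] C] Hin.
  (* The equation is given only for colours below [k], and every place that occurs in the terms has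
     such a colour. *)
  assert (HC : (C < k)%nat).
  { rewrite map_app, in_app_iff in Hin. destruct Hin as [Hin|Hin];
      apply in_map_iff in Hin; destruct Hin as ([p z] & Hp & Hin); simpl in Hp; subst p.
    - unfold token_terms in Hin. apply in_map_iff in Hin.
      destruct Hin as ([[x y] c] & [= _ _ _ <- _] & Hin). eapply HF, Hin.
    - apply in_flat_map in Hin. destruct Hin as ([[x y] t] & Ht & Hin).
      apply HL, HT in Ht. destruct t as [[[cN cE] cS] cW].
      destruct Ht as (? & ? & ? & ?).
      destruct Hin as [[= _ _ _ <- _]|[[= _ _ _ <- _]|[[= _ _ _ <- _]|[[= _ _ _ <- _]|[]]]]];
        assumption. }
  rewrite lin_app. specialize (H _ _ (edge_end_adjacent h X Y) C HC).
  rewrite tiling_sum_delta, Hf in H. exact H.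
Qed.

Lemma zero_tiling_sum_of_val k T f F L :
  represents_tokens f F -> (forall x y t, In (x, y, t) L -> In t T) ->
  (forall phi, tokens_val phi F + sum_val phi L = 0) -> zero_tiling_sum k 0 T f.
Proof.
  intros [Hs Hf] HL H. exists L. split; [exact HL|]. intros u v Huv c _.
  destruct (adjacent_cases u v Huv) as (h & x & y & [[-> ->]|[-> ->]]).
  - rewrite Hf, tiling_sum_delta. apply H.
  - rewrite Hs, tiling_sum_sym, Hf, tiling_sum_delta. apply H.
Qed.

(** * Chains, generators and their potentials *)

Inductive dir : Type := DN | DE | DS | DW.

Definition dir_dec (a b : dir) : {a = b} + {a <> b}.
Proof. decide equality. Defined.

Definition opp (d : dir) : dir :=
  match d with DN => DS | DE => DW | DS => DN | DW => DE end.
Definition dir_x (d : dir) : Z := match d with DE => 1 | DW => -1 | _ => 0 end.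
Definition dir_y (d : dir) : Z := match d with DN => 1 | DS => -1 | _ => 0 end.

Definition weight (phi : place -> Z) (p : place) : Z := nd 0 (snd p) * phi p.

Definition side (phi : place -> Z) (d : dir) (x y : Z) (c : nat) : Z :=
  match d with
  | DN => weight phi (true, x, y + 1, c)
  | DE => weight phi (false, x + 1, y, c)
  | DS => - weight phi (true, x, y, c)
  | DW => - weight phi (false, x, y, c)
  end.

(** A shared edge counts with opposite signs in its two cells, so the link colours telescope along a
    chain. *)
Lemma side_opp phi d x y c : side phi (opp d) (x + dir_x d) (y + dir_y d) c = - side phi d x y c.
Proof.
  destruct d; simpl; rewrite ?Z.add_0_r, ?Z.opp_involutive; try reflexivity; repeat f_equal; lia.
Qed.

Lemma side_0 phi d x y : side phi d x y 0 = 0.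
Proof. destruct d; reflexivity. Qed.

Definition tile_of (f : dir -> nat) : tile := (f DN, f DE, f DS, f DW).

Definition put (d : dir) (c : nat) (f : dir -> nat) : dir -> nat :=
  fun d' => if dir_dec d d' then c else f d'.

Definition blank : dir -> nat := fun _ => 0%nat.

Lemma tile_val_of phi x y f : tile_val phi x y (tile_of f) =
  side phi DN x y (f DN) + side phi DE x y (f DE) + side phi DS x y (f DS) + side phi DW x y (f DW).
Proof. unfold tile_val, tile_of, tile_terms, side, weight. simpl. lia. Qed.

(* A path lists the sides through which a chain of tiles leaves its cells,
   each with a colour for the north side of the cell (0 if none). The links
   between consecutive tiles use the private colours [n], [n + 1], ...; the
   last tile shows [q] on its north side and [s] on its south side. *)
Fixpoint chain (x y : Z) (a : dir) (c n : nat) (path : list (dir * nat)) (q s : nat)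
  : list (Z * Z * tile) :=
  match path with
  | nil => [(x, y, tile_of (put a c (put DN q (put DS s blank))))]
  | (d, e) :: path =>
      (x, y, tile_of (put a c (put d n (put DN e blank)))) ::
      chain (x + dir_x d) (y + dir_y d) (opp d) n (S n) path q s
  end.

(** [put] overwrites, so the sides used in one cell must be distinct. In the last cell both north
    and south must stay free for [q] and [s]. *)
Fixpoint valid (a : dir) (path : list (dir * nat)) : Prop :=
  match path with
  | nil => a <> DN /\ a <> DS
  | (d, e) :: path => a <> d /\ (e = 0%nat \/ (a <> DN /\ d <> DN)) /\ valid (opp d) path
  end.

Fixpoint path_val (phi : place -> Z) (x y : Z) (path : list (dir * nat)) (q s : nat) : Z :=
  match path with
  | nil => side phi DN x y q + side phi DS x y s
  | (d, e) :: path => side phi DN x y e + path_val phi (x + dir_x d) (y + dir_y d) path q s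
  end.

Lemma end_tile_val phi x y a c q s : a <> DN -> a <> DS ->
  tile_val phi x y (tile_of (put a c (put DN q (put DS s blank)))) =
  side phi a x y c + side phi DN x y q + side phi DS x y s.
Proof.
  intros H1 H2. rewrite tile_val_of. destruct a; try congruence;
    cbn [put dir_dec dir_rec dir_rect blank]; unfold put, blank; simpl dir_dec;
    cbn iota; rewrite ?side_0; lia.
Qed.

Lemma link_tile_val phi x y a c d n e : a <> d -> e = 0%nat \/ (a <> DN /\ d <> DN) ->
  tile_val phi x y (tile_of (put a c (put d n (put DN e blank)))) =
  side phi a x y c + side phi d x y n + side phi DN x y e.
Proof.
  intros H1 H2. rewrite tile_val_of.
  destruct a, d; try congruence; unfold put, blank; simpl dir_dec; cbn iota;
    destruct H2 as [->|[]]; try congruence; rewrite ?side_0; lia.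
Qed.

Lemma chain_val phi path q s : forall x y a c n, valid a path ->
  sum_val phi (chain x y a c n path q s) = side phi a x y c + path_val phi x y path q s.
Proof.
  induction path as [|[d e] path IH]; intros x y a c n; cbn [chain valid path_val].
  - intros []. rewrite sum_val_cons, end_tile_val by assumption.
    change (sum_val phi []) with 0. lia.
  - intros (H1 & H2 & Hv).
    rewrite sum_val_cons, IH, link_tile_val, side_opp by assumption. lia.
Qed.

Lemma chain_translate path q s X Y t : forall x y a c n dx dy,
  In (X, Y, t) (chain x y a c n path q s) ->
  In (X + dx, Y + dy, t) (chain (x + dx) (y + dy) a c n path q s).
Proof.
  induction path as [|[d e] path IH]; intros x y a c n dx dy; simpl.
  - intros [[= <- <- <-]|[]]. auto.
  - intros [[= <- <- <-]|H]; [auto|]. right.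
    apply (IH _ _ _ _ _ dx dy) in H.
    replace (x + dx + dir_x d) with (x + dir_x d + dx) by lia.
    now replace (y + dy + dir_y d) with (y + dir_y d + dy) by lia.
Qed.

Lemma chain_tile_ok path q s k : (0 < k)%nat -> forall x y a c n X Y t,
  In (X, Y, t) (chain x y a c n path q s) ->
  (c < k)%nat -> (q < k)%nat -> (s < k)%nat -> (n + length path <= k)%nat ->
  Forall (fun '(_, e) => (e < k)%nat) path -> tile_ok k t.
Proof.
  intros Hk. assert (Hput : forall f d c, (c < k)%nat -> (forall d', f d' < k)%nat ->
    forall d', (put d c f d' < k)%nat).
  { intros f d c Hc Hf d'. unfold put. destruct (dir_dec d d'); auto. }
  induction path as [|[d e] path IH]; intros x y a c n X Y t; simpl.
  - intros [[= <- <- <-]|[]] Hc Hq Hs _ _.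
    repeat split; repeat apply Hput; auto.
  - intros [[= <- <- <-]|H] Hc Hq Hs Hn He; inversion He; subst.
    + assert (n < k)%nat by lia. repeat split; repeat apply Hput; auto.
    + eapply IH; eauto; lia.
Qed.

Definition agree (n : nat) (phi phi' : place -> Z) : Prop :=
  forall h x y c, (c < n)%nat -> phi' (h, x, y, c) = phi (h, x, y, c).

Lemma side_agree n phi phi' d x y c : agree n phi phi' -> (c < n)%nat ->
  side phi' d x y c = side phi d x y c.
Proof. intros H Hc. destruct d; simpl; unfold weight; now rewrite H. Qed.

Lemma tile_val_agree n phi phi' x y t : agree n phi phi' -> tile_ok n t ->
  tile_val phi' x y t = tile_val phi x y t.
Proof.
  destruct t as [[[cN cE] cS] cW]. intros H (? & ? & ? & ?).
  unfold tile_val, tile_terms. simpl. now rewrite !H.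
Qed.

Lemma path_val_agree n phi phi' path q s : agree n phi phi' ->
  (q < n)%nat -> (s < n)%nat -> Forall (fun '(_, e) => (e < n)%nat) path ->
  forall x y, path_val phi' x y path q s = path_val phi x y path q s.
Proof.
  intros H Hq Hs. induction 1 as [|[d e] path He _ IH]; intros x y; cbn [path_val].
  - now rewrite !(side_agree n phi phi') by assumption.
  - now rewrite (side_agree n phi phi'), IH by assumption.
Qed.

(* Potential on the link colour [n] making the rest of a chain entered
   through side [a], whose remaining value is [V], worth exactly 0. *)
Definition link_pot (a : dir) (n : nat) (V : Z -> Z -> Z) (phi : place -> Z) : place -> Z :=
  fun '(h, x, y, c) =>
    if Nat.eqb c n then
      match a with DS | DW => V x y | DN => - V x (y - 1) | DE => - V (x - 1) y end
    else phi (h, x, y, c).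

Lemma link_pot_agree a n V phi : agree n phi (link_pot a n V phi).
Proof. intros h x y c Hc. simpl. destruct (Nat.eqb_spec c n); [lia | reflexivity]. Qed.

Lemma link_pot_side a n V phi x y : (0 < n)%nat ->
  side (link_pot a n V phi) a x y n = - V x y.
Proof.
  intros Hn. destruct n as [|n]; [lia|].
  destruct a; unfold side, weight, link_pot; cbn [snd]; change (nd 0 (S n)) with 1;
    rewrite Nat.eqb_refl, ?Z.add_simpl_r; lia.
Qed.

(** Link colours occur nowhere else, so their potentials can be chosen freely, and the first tile
    can be made to carry the value of the whole chain. A nonnegative chain thus gives nonnegative
    single tiles, which covers sums that use fragments of chains. *)
Lemma chain_potential path q s : forall phi (R : Z -> Z -> Prop) a c n,
  valid a path -> (c < n)%nat -> (q < n)%nat -> (s < n)%nat ->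
  Forall (fun '(_, e) => (e < n)%nat) path ->
  (forall x y, R x y -> 0 <= side phi a x y c + path_val phi x y path q s) ->
  exists phi', agree n phi phi' /\
    forall x y, R x y -> forall X Y t, In (X, Y, t) (chain x y a c n path q s) ->
      0 <= tile_val phi' X Y t.
Proof.
  induction path as [|[d e] path IH]; intros phi R a c n Hv Hc Hq Hs Hp HR.
  - exists phi. split; [intros h x y c' _; reflexivity|].
    intros x y Hxy X Y t [[= <- <- <-]|[]]. destruct Hv.
    rewrite end_tile_val by assumption. specialize (HR x y Hxy). cbn [path_val] in HR. lia.
  - destruct Hv as (H1 & H2 & Hv). inversion Hp as [|? ? He Hp']; subst.
    set (V := fun x y => path_val phi x y path q s).
    set (phi1 := link_pot (opp d) n V phi).
    assert (A1 : agree n phi phi1) by apply link_pot_agree.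
    assert (S1 : forall x y, side phi1 (opp d) x y n = - V x y) by
      (intros; apply link_pot_side; lia).
    assert (HV : forall x y, path_val phi1 x y path q s = V x y) by
      (intros; eapply path_val_agree; eassumption).
    (* By the choice of [phi1] the remaining chain is worth 0 at every position, so [R] matters for
       the first tile only. *)
    destruct (IH phi1 (fun _ _ => True) (opp d) n (S n)) as (phi' & A' & H'); auto; try lia.
    { eapply Forall_impl; [|exact Hp']. intros []. lia. }
    { intros x y _. rewrite S1, HV. lia. }
    assert (A : agree n phi phi').
    { intros h x y c' Hc'. rewrite A' by lia. now apply A1. }
    exists phi'. split; [exact A|].
    intros x y Hxy X Y t [[= <- <- <-]|Hin]; [|eapply H'; [exact I | exact Hin]].
    rewrite link_tile_val by assumption.
    rewrite (side_agree n phi phi' a), (side_agree n phi phi' DN) by assumption.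
    assert (E : side phi' d x y n = V (x + dir_x d) (y + dir_y d)).
    { rewrite <- (Z.opp_involutive (side _ _ _ _ _)), <- side_opp.
      rewrite (side_agree (S n) phi1 phi') by (auto; lia). rewrite S1. lia. }
    rewrite E. specialize (HR x y Hxy). cbn [path_val] in HR.
    fold (V (x + dir_x d) (y + dir_y d)) in HR.
    lia.
Qed.

(* The generator consumes a token [src] at the origin, produces [dst] at
   [(dx, dy)] and [mark] at [(-off, 1)], and consumes [aux] at [(dx, dy - 1)];
   colour 0 stands for no token. *)
Record gen : Type := Gen
  { src : nat; dx : Z; dy : Z; dst : nat; off : nat; mark : nat; aux : nat }.

Definition gen_val (phi : place -> Z) (x y : Z) (g : gen) : Z :=
  - weight phi (true, x, y, src g)
  + weight phi (true, x + dx g, y + dy g, dst g)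
  + weight phi (true, x - Z.of_nat (off g), y + 1, mark g)
  - weight phi (true, x + dx g, y + dy g - 1, aux g).

(* The extra steps make every run nonempty, so that the path never reverses
   and its last cell is entered from the west. *)
Definition gen_path (g : gen) : list (dir * nat) :=
  repeat (DW, 0%nat) (off g) ++ (DW, mark g) ::
  repeat (DW, 0%nat) (S (Z.to_nat (- dx g))) ++
  repeat (DN, 0%nat) (S (Z.to_nat (dy g - 1))) ++
  repeat (DE, 0%nat) (S (off g + Z.to_nat (dx g))) ++
  repeat (DS, 0%nat) (S (Z.to_nat (1 - dy g))) ++ [(DE, 0%nat)].

Lemma path_val_run phi d m path q s : forall x y,
  path_val phi x y (repeat (d, 0%nat) m ++ path) q s =
  path_val phi (x + Z.of_nat m * dir_x d) (y + Z.of_nat m * dir_y d) path q s.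
Proof.
  induction m as [|m IH]; intros x y.
  - simpl repeat. cbn [app]. f_equal; lia.
  - cbn [repeat app path_val]. rewrite side_0, IH. simpl Z.add at 1.
    f_equal; lia.
Qed.

Lemma valid_run d m path : forall a, a <> d -> valid (opp d) path ->
  valid a (repeat (d, 0%nat) (S m) ++ path).
Proof.
  induction m as [|m IH]; intros a Ha Hv.
  - cbn [repeat app valid]. auto.
  - change (repeat (d, 0%nat) (S (S m)) ++ path) with
      ((d, 0%nat) :: (repeat (d, 0%nat) (S m) ++ path)).
    cbn [valid]. split; [exact Ha|]. split; [auto|]. apply IH; [destruct d; discriminate | exact Hv].
Qed.

Lemma gen_path_valid g : valid DS (gen_path g).
Proof.
  unfold gen_path.
  assert (H : forall m a path, a <> DW -> a <> DN -> valid DE path ->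
    valid a (repeat (DW, 0%nat) m ++ (DW, mark g) :: path)).
  { clear. induction m as [|m IH]; intros a path H1 H2 Hv; simpl.
    - repeat split; auto. right. split; [auto | discriminate].
    - repeat split; auto. apply IH; auto; discriminate. }
  apply H; try discriminate.
  repeat (apply valid_run; [discriminate|]). simpl. repeat split; auto; discriminate.
Qed.

Lemma gen_path_val phi x y g :
  side phi DS x y (src g) + path_val phi x y (gen_path g) (dst g) (aux g) = gen_val phi x y g.
Proof.
  unfold gen_path. rewrite path_val_run. cbn [path_val]. rewrite !path_val_run.
  cbn [path_val]. rewrite side_0. unfold gen_val, side.
  cbn [dir_x dir_y].
  match goal with |- _ + (weight phi (true, ?x1, ?y1, _) +
      (0 + (weight phi (true, ?x2, ?y2, _) + - weight phi (true, ?x2, ?y3, _)))) = _ =>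
    replace x2 with (x + dx g) by lia;
    replace y2 with (y + dy g) by lia;
    replace y3 with (y + dy g - 1) by lia;
    replace x1 with (x - Z.of_nat (off g)) by lia;
    replace y1 with (y + 1) by lia
  end. lia.
Qed.

Definition gen_bound (k : nat) (g : gen) : Prop :=
  (0 < src g < k)%nat /\ (dst g < k)%nat /\ (mark g < k)%nat /\ (aux g < k)%nat.

Lemma gen_path_colors k g : gen_bound k g -> Forall (fun '(_, e) => (e < k)%nat) (gen_path g).
Proof.
  intros (? & _ & Hm & _).
  assert (H0 : forall d m, Forall (fun '(_, e) => (e < k)%nat) (repeat (d : dir, 0%nat) m)).
  { intros d m. apply Forall_forall. intros [d' e] Hin. apply repeat_spec in Hin.
    injection Hin as -> ->. lia. }
  unfold gen_path. apply Forall_app. split; [apply H0|]. constructor; [exact Hm|].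
  repeat (apply Forall_app; split; [apply H0|]). constructor; [lia | constructor].
Qed.

Fixpoint gen_chains (gs : list gen) (n : nat) : list (Z * Z * tile) :=
  match gs with
  | nil => nil
  | g :: gs => chain 0 0 DS (src g) n (gen_path g) (dst g) (aux g) ++
               gen_chains gs (n + length (gen_path g))
  end.

Fixpoint colors_end (gs : list gen) (n : nat) : nat :=
  match gs with nil => n | g :: gs => colors_end gs (n + length (gen_path g)) end.

Lemma colors_end_le gs : forall n, (n <= colors_end gs n)%nat.
Proof.
  induction gs as [|g gs IH]; intros n; simpl; [lia|].
  specialize (IH (n + length (gen_path g))%nat). lia.
Qed.

Lemma gen_bound_le n m g : (n <= m)%nat -> gen_bound n g -> gen_bound m g.
Proof. unfold gen_bound. lia. Qed.

Lemma gen_chains_ok gs : forall n X Y t, Forall (gen_bound n) gs ->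
  In (X, Y, t) (gen_chains gs n) -> tile_ok (colors_end gs n) t.
Proof.
  induction gs as [|g gs IH]; intros n X Y t Hg; [intros []|]. simpl.
  inversion Hg as [|? ? Hb Hg']; subst.
  pose proof (colors_end_le gs (n + length (gen_path g))) as Hle.
  rewrite in_app_iff. intros [H|H].
  - assert (Hb' : gen_bound (colors_end gs (n + length (gen_path g))) g) by
      (eapply gen_bound_le; [|exact Hb]; lia).
    pose proof (gen_path_colors _ _ Hb'). destruct Hb' as (? & ? & ? & ?).
    eapply chain_tile_ok; [|exact H|..]; auto; lia.
  - eapply IH; [|exact H]. eapply Forall_impl; [|exact Hg'].
    intros g'. apply gen_bound_le. lia.
Qed.

Lemma weight_agree n phi phi' h x y c : agree n phi phi' -> (c < n)%nat ->
  weight phi' (h, x, y, c) = weight phi (h, x, y, c).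
Proof. intros H Hc. unfold weight. now rewrite H. Qed.

Lemma gen_val_agree n phi phi' x y g : agree n phi phi' -> gen_bound n g ->
  gen_val phi' x y g = gen_val phi x y g.
Proof.
  intros H (? & ? & ? & ?). unfold gen_val. now rewrite !(weight_agree n phi phi') by (auto; lia).
Qed.

(** Each generator has its own interval of link colours, so the potentials of successive chains
    extend one another without conflict. *)
Lemma gen_chains_potential gs (R : Z -> Z -> Prop) : forall n phi, Forall (gen_bound n) gs ->
  (forall g x y, In g gs -> R x y -> 0 <= gen_val phi x y g) ->
  exists phi', agree n phi phi' /\
    forall x y, R x y -> forall X Y t, In (X, Y, t) (gen_chains gs n) ->
      0 <= tile_val phi' (X + x) (Y + y) t.
Proof.
  induction gs as [|g gs IH]; intros n phi Hg HR.
  - exists phi. split; [intros h x y c _; reflexivity | intros x y _ X Y t []].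
  - inversion Hg as [|? ? Hb Hg']; subst.
    pose proof (gen_path_colors _ _ Hb) as Hp. pose proof Hb as (Hb1 & Hb2 & Hb3 & Hb4).
    destruct (chain_potential (gen_path g) (dst g) (aux g) phi R DS (src g) n)
      as (phi1 & A1 & H1); auto using gen_path_valid; try lia.
    { intros x y Hxy. rewrite gen_path_val. apply HR; [now left | exact Hxy]. }
    set (m := (n + length (gen_path g))%nat).
    assert (Hg1 : Forall (gen_bound m) gs) by
      (eapply Forall_impl; [|exact Hg']; intros g'; apply gen_bound_le; lia).
    destruct (IH m phi1) as (phi' & A' & H'); auto.
    { intros g' x y Hin Hxy. rewrite (gen_val_agree n phi).
      - apply HR; [now right | exact Hxy].
      - exact A1.
      - eapply Forall_forall in Hg'; eauto. }
    exists phi'. split.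
    + intros h x y c Hc. rewrite A' by lia. now apply A1.
    + intros x y Hxy X Y t Hin. simpl in Hin. rewrite in_app_iff in Hin.
      destruct Hin as [Hin|Hin]; [|now apply H'].
      assert (Ht : tile_ok m t).
      { eapply chain_tile_ok; [|exact Hin|..]; try lia.
        eapply Forall_impl; [|exact Hp]. intros []. lia. }
      rewrite (tile_val_agree m phi1) by assumption.
      eapply H1; [exact Hxy|]. apply (chain_translate _ _ _ _ _ _ _ _ _ _ _ x y) in Hin. exact Hin.
Qed.

(** * Equivalence of tiles and generators *)

Definition gens_sum (phi : place -> Z) (A : list (Z * Z * gen)) : Z :=
  fold_right (fun '(x, y, g) acc => gen_val phi x y g + acc) 0 A.

(** Asking for the equation under all potentials expresses equality of formal sums, with no order or
    normal form of the tokens. *)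
Definition solvable (gs : list gen) (F : tokens) : Prop :=
  exists A, (forall x y g, In (x, y, g) A -> In g gs) /\
    forall phi, tokens_val phi F + gens_sum phi A = 0.

Lemma gen_chains_in g gs : In g gs -> forall n, exists m, forall X Y t,
  In (X, Y, t) (chain 0 0 DS (src g) m (gen_path g) (dst g) (aux g)) ->
  In (X, Y, t) (gen_chains gs n).
Proof.
  induction gs as [|g' gs IH]; intros Hin n; [destruct Hin|]. simpl.
  destruct Hin as [->|Hin].
  - exists n. intros. apply in_or_app. now left.
  - destruct (IH Hin (n + length (gen_path g'))%nat) as [m Hm]. exists m.
    intros. apply in_or_app. right. now apply Hm.
Qed.

Lemma gens_complete gs n k f F : represents_tokens f F -> solvable gs F ->
  zero_tiling_sum k 0 (map snd (gen_chains gs n)) f.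
Proof.
  intros Hf (A & HA & H).
  assert (HL : exists L, (forall x y t, In (x, y, t) L -> In t (map snd (gen_chains gs n))) /\
            forall phi, sum_val phi L = gens_sum phi A).
  { clear H. induction A as [|[[x y] g] A IH].
    - exists nil. split; [intros x y t [] | reflexivity].
    - destruct IH as (L & HL & HS); [intros; eapply HA; right; eassumption|].
      destruct (gen_chains_in g gs (HA x y g (or_introl eq_refl)) n) as [m Hm].
      exists (chain x y DS (src g) m (gen_path g) (dst g) (aux g) ++ L). split.
      + intros X Y t Hin. apply in_app_or in Hin. destruct Hin as [Hin|Hin]; [|eauto].
        apply (chain_translate _ _ _ _ _ _ _ _ _ _ _ (- x) (- y)) in Hin.
        rewrite !Z.add_opp_diag_r in Hin. apply Hm in Hin.
        apply in_map_iff. eexists. split; [|exact Hin]. reflexivity.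
      + intros phi. rewrite sum_val_app, HS, chain_val, gen_path_val by apply gen_path_valid.
        reflexivity. }
  destruct HL as (L & HL & HS). eapply zero_tiling_sum_of_val; [exact Hf | exact HL|].
  intros phi. rewrite HS. apply H.
Qed.

Lemma list_bounded (l : list (Z * Z)) : exists B, forall x y, In (x, y) l -> x <= B /\ y <= B.
Proof.
  induction l as [|[x y] l [B HB]].
  - exists 0. intros x y [].
  - exists (Z.max B (Z.max x y)). intros x' y' [[= <- <-]|H]; [lia|].
    specialize (HB _ _ H). lia.
Qed.

Lemma gens_sound gs n f F : represents_tokens f F -> Forall (gen_bound n) gs ->
  (forall x y c, In (x, y, c) F -> (c < n)%nat) ->
  (forall B, exists phi, 0 < tokens_val phi F /\
     forall g x y, In g gs -> x <= B -> y <= B -> 0 <= gen_val phi x y g) ->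
  ~ zero_tiling_sum (colors_end gs n) 0 (map snd (gen_chains gs n)) f.
Proof.
  intros Hf Hg HF HB (L & HL & H).
  pose proof (colors_end_le gs n) as Hle.
  assert (Hok : forall t, In t (map snd (gen_chains gs n)) -> tile_ok (colors_end gs n) t).
  { intros t Ht. apply in_map_iff in Ht. destruct Ht as ([[X Y] t'] & Ht & Hin).
    simpl in Ht. subst t'. eapply gen_chains_ok; eassumption. }
  (* A tile of [L] at (x, y) can be the cell (X, Y) of a chain based at (x - X, y - Y). There are
     finitely many such bases, and the potential may depend on a bound for them. *)
  destruct (list_bounded (flat_map (fun '(x, y, _) =>
    map (fun '(X, Y, _) => (x - X, y - Y)) (gen_chains gs n)) L)) as [B HBd].
  destruct (HB B) as (phi & Hpos & Hphi).
  destruct (gen_chains_potential gs (fun x y => x <= B /\ y <= B) n phi Hg)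
    as (phi' & A & Hphi').
  { intros g x y Hin []. now apply Hphi. }
  assert (HFv : tokens_val phi' F = tokens_val phi F).
  { clear - HF A. unfold tokens_val, token_terms.
    induction F as [|[[x y] c] F IH]; [reflexivity|]. simpl.
    rewrite IH by (intros; eapply HF; right; eassumption).
    rewrite A; [reflexivity|]. eapply HF. left. reflexivity. }
  assert (Hsum : tokens_val phi' F + sum_val phi' L = 0).
  { eapply zero_sum_val; eauto. intros x y c Hin. specialize (HF x y c Hin). lia. }
  assert (0 <= sum_val phi' L); [|lia].
  apply sum_val_nonneg. intros x y t Hin.
  pose proof (HL x y t Hin) as Ht. apply in_map_iff in Ht.
  destruct Ht as ([[X Y] t'] & Ht & Hin'). simpl in Ht. subst t'.
  specialize (Hphi' (x - X) (y - Y)). replace x with (X + (x - X)) by lia.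
  replace y with (Y + (y - Y)) by lia. eapply Hphi'; [|exact Hin'].
  apply HBd. apply in_flat_map. exists (x, y, t). split; [exact Hin|].
  apply in_map_iff. exists (X, Y, t). auto.
Qed.

(** * The walker *)

Lemma tokens_val_cons phi x y c F :
  tokens_val phi ((x, y, c) :: F) = weight phi (true, x, y, c) + tokens_val phi F.
Proof. reflexivity. Qed.

Lemma tokens_val_app phi F F' : tokens_val phi (F ++ F') = tokens_val phi F + tokens_val phi F'.
Proof. unfold tokens_val, token_terms. now rewrite map_app, lin_app. Qed.

Lemma weight_0 phi h x y : weight phi (h, x, y, 0%nat) = 0.
Proof. reflexivity. Qed.

Lemma solvable_step gs F F' x y g : In g gs ->
  (forall phi, tokens_val phi F' = tokens_val phi F + gen_val phi x y g) ->
  solvable gs F' -> solvable gs F.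
Proof.
  intros Hg HF (A & HA & H). exists ((x, y, g) :: A). split.
  - intros x' y' g' [[= <- <- <-]|Hin]; eauto.
  - intros phi. specialize (H phi). rewrite HF in H. simpl. lia.
Qed.

Lemma solvable_ext gs F F' : (forall phi, tokens_val phi F = tokens_val phi F') ->
  solvable gs F' -> solvable gs F.
Proof. intros HF (A & HA & H). exists A. split; [exact HA|]. intros phi. now rewrite HF. Qed.

Lemma solvable_move gs c ux uy c' o m x y F : In (Gen c ux uy c' o m 0) gs ->
  solvable gs ((x + ux, y + uy, c') :: (x - Z.of_nat o, y + 1, m) :: F) ->
  solvable gs ((x, y, c) :: F).
Proof.
  intros Hg. apply (solvable_step _ _ _ x y _ Hg). intros phi.
  rewrite !tokens_val_cons. unfold gen_val. simpl src; simpl dx; simpl dy; simpl dst;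
    simpl off; simpl mark; simpl aux. rewrite weight_0. lia.
Qed.

Lemma solvable_blank gs x y F : solvable gs F -> solvable gs ((x, y, 0%nat) :: F).
Proof. apply solvable_ext. intros phi. now rewrite tokens_val_cons, weight_0. Qed.

Lemma solvable_swap gs t1 t2 F : solvable gs (t1 :: t2 :: F) -> solvable gs (t2 :: t1 :: F).
Proof.
  destruct t1 as [[x1 y1] c1], t2 as [[x2 y2] c2].
  apply solvable_ext. intros phi. rewrite !tokens_val_cons. lia.
Qed.

Lemma solvable_jump gs c ux uy c' x y F : In (Gen c ux uy c' 0 0 0) gs ->
  solvable gs ((x + ux, y + uy, c') :: F) -> solvable gs ((x, y, c) :: F).
Proof.
  intros Hg H. eapply solvable_move; [exact Hg|]. now apply solvable_swap, solvable_blank.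
Qed.

Lemma solvable_walk gs c ux uy F : In (Gen c ux uy c 0 0 0) gs -> forall m x y,
  solvable gs ((x + Z.of_nat m * ux, y + Z.of_nat m * uy, c) :: F) ->
  solvable gs ((x, y, c) :: F).
Proof.
  intros Hg. induction m as [|m IH]; intros x y H.
  - simpl in H. now rewrite !Z.add_0_r in H.
  - eapply solvable_jump; [exact Hg|]. apply IH.
    replace (x + ux + Z.of_nat m * ux) with (x + Z.of_nat (S m) * ux) by lia.
    now replace (y + uy + Z.of_nat m * uy) with (y + Z.of_nat (S m) * uy) by lia.
Qed.

Lemma solvable_walk_both gs c ux uy F x y j :
  In (Gen c ux uy c 0 0 0) gs -> In (Gen c (- ux) (- uy) c 0 0 0) gs ->
  solvable gs ((x + j * ux, y + j * uy, c) :: F) -> solvable gs ((x, y, c) :: F).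
Proof.
  intros H1 H2 H. destruct (Z.le_ge_cases 0 j).
  - apply (solvable_walk gs c ux uy F H1 (Z.to_nat j)). now rewrite Z2Nat.id.
  - apply (solvable_walk gs c (- ux) (- uy) F H2 (Z.to_nat (- j))). rewrite Z2Nat.id by lia.
    now rewrite !Z.mul_opp_opp.
Qed.

(* The colours of the walker: [VX] certifies that its token lies on the line
   x = 0 and is absorbed by the climbing token [GX], which starts at (0, 0);
   [VY] and [GY] do the same for the line y = 1. *)
Definition VX := 1%nat.
Definition VY := 2%nat.
Definition GX := 3%nat.
Definition GY := 4%nat.
Definition stA (q : nat) : nat := 5 + 3 * q.
Definition stB (q : nat) : nat := 6 + 3 * q.
Definition stC (q : nat) : nat := 7 + 3 * q.

(** Certificates slide along their line because tests happen in any order, while a climbing token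
    meets positions in increasing order. A mark appears one row above its test and [aux] is taken
    one row below [dst]: tests at y = 0 leave [VY] at y = 1, and [GY] runs along y = 2. *)
Definition pool_gens : list gen :=
  [Gen VX 0 1 VX 0 0 0; Gen VX 0 (-1) VX 0 0 0;
   Gen VY 1 0 VY 0 0 0; Gen VY (-1) 0 VY 0 0 0;
   Gen GX 0 1 GX 0 0 VX; Gen GX 0 0 0 0 0 0;
   Gen GY 1 0 GY 0 0 VY; Gen GY 0 0 0 0 0 0].

(* The number n in state q is the token [stA q] at (n, 0). It moves by
   (-d, 1) until it sits at (r, n / d) with r = n mod d. If r = 0 it comes
   back to the line y = 0 by steps (p, -1) as [stB q], otherwise by steps
   (d, -1) as [stC q]. *)
Definition instr_gens (q : nat) (i : instr) : list gen :=
  match i with (d, p, q1, q2) =>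
    [Gen (stA q) (- Z.of_nat d) 1 (stA q) 0 0 0;
     Gen (stA q) 0 0 (stB q) 0 VX 0;
     Gen (stB q) (Z.of_nat p) (-1) (stB q) 0 0 0;
     Gen (stB q) 0 0 (stA q1) 0 VY 0;
     Gen (stC q) (Z.of_nat d) (-1) (stC q) 0 0 0;
     Gen (stC q) 0 0 (stA q2) 0 VY 0] ++
    map (fun r => Gen (stA q) 0 0 (stC q) r VX 0) (seq 1 (d - 1))
  end.

Definition machine_gens (M : list instr) (acc : nat) : list gen :=
  Gen (stA acc) 0 0 0 0 0 0 :: pool_gens ++
  flat_map (fun q => match nth_error M q with
                     | Some i => instr_gens q i
                     | None => nil
                     end) (seq 0 (length M)).

Lemma instr_gens_in M acc q i g : nth_error M q = Some i -> In g (instr_gens q i) ->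
  In g (machine_gens M acc).
Proof.
  intros Hq Hg. right. apply in_or_app. right. apply in_flat_map. exists q. split.
  - apply in_seq. assert (q < length M)%nat by (apply nth_error_Some; congruence). lia.
  - now rewrite Hq.
Qed.

Lemma machine_gens_inv M acc g : In g (machine_gens M acc) ->
  g = Gen (stA acc) 0 0 0 0 0 0 \/ In g pool_gens \/
  exists q i, nth_error M q = Some i /\ In g (instr_gens q i).
Proof.
  intros [<-|H]; [auto|]. apply in_app_or in H. destruct H as [H|H]; [auto|].
  right. right. apply in_flat_map in H. destruct H as (q & _ & H).
  destruct (nth_error M q) as [i|] eqn:E; [eauto | destruct H].
Qed.

Definition on_x (l : Z) : Z * Z * nat := (0, l, VX).
Definition on_y (l : Z) : Z * Z * nat := (l, 1, VY).

Definition certified (vx vy : list Z) (j l : Z) : tokens :=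
  map on_x vx ++ map on_y vy ++ [(0, j, GX); (l, 2, GY)].

(** A run is read backwards from acceptance, so the certificates issued before the current moment
    are arbitrary. *)
Definition winning (gs : list gen) (c : nat) (x y : Z) : Prop :=
  forall vx vy, solvable gs ((x, y, c) :: certified vx vy 0 0).

Lemma pool_gens_in M acc g : In g pool_gens -> In g (machine_gens M acc).
Proof. intros H. right. apply in_or_app. now left. Qed.

Lemma certified_solvable M acc vx : forall vy j l,
  solvable (machine_gens M acc) (certified vx vy j l).
Proof.
  assert (HP := pool_gens_in M acc). set (gs := machine_gens M acc) in *.
  induction vx as [|a vx IHx]; intros vy; [induction vy as [|b vy IHy]|]; intros j l.
  - unfold certified. simpl.
    apply (solvable_step _ _ [(l, 2, GY)] 0 j (Gen GX 0 0 0 0 0 0)).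
    { apply HP. simpl; tauto. }
    { intros phi. rewrite !tokens_val_cons. unfold gen_val. cbn [src dx dy dst off mark aux].
      rewrite !weight_0. lia. }
    apply (solvable_step _ _ [] l 2 (Gen GY 0 0 0 0 0 0)).
    { apply HP. simpl; tauto. }
    { intros phi. rewrite !tokens_val_cons. unfold gen_val. cbn [src dx dy dst off mark aux].
      rewrite !weight_0. lia. }
    exists nil. split; [intros x y g [] | reflexivity].
  - unfold certified. simpl.
    apply (solvable_walk_both gs VY 1 0 _ b 1 (l + 1 - b)).
    { apply HP. simpl; tauto. }
    { apply HP. simpl; tauto. }
    apply (solvable_step _ _ (certified [] vy j (l + 1)) l 2 (Gen GY 1 0 GY 0 0 VY)).
    { apply HP. simpl; tauto. }
    { intros phi. unfold certified. cbn [map app].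
      rewrite tokens_val_cons, !tokens_val_app, !tokens_val_cons.
      unfold gen_val. cbn [src dx dy dst off mark aux]. rewrite !weight_0.
      replace (b + (l + 1 - b) * 1) with (l + 1) by lia.
      replace (1 + (l + 1 - b) * 0) with 1 by lia.
      change (2 + 0) with 2. change (2 - 1) with 1. lia. }
    apply IHy.
  - unfold certified. simpl.
    apply (solvable_walk_both gs VX 0 1 _ 0 a (j - a)).
    { apply HP. simpl; tauto. }
    { apply HP. simpl; tauto. }
    apply (solvable_step _ _ (certified vx vy (j + 1) l) 0 j (Gen GX 0 1 GX 0 0 VX)).
    { apply HP. simpl; tauto. }
    { intros phi. unfold certified.
      rewrite tokens_val_cons, !tokens_val_app, !tokens_val_cons.
      unfold gen_val. cbn [src dx dy dst off mark aux]. rewrite !weight_0.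
      replace (0 + (j - a) * 0) with 0 by lia.
      replace (a + (j - a) * 1) with j by lia.
      change (0 + 0) with 0. replace (j + 1 - 1) with j by lia. lia. }
    apply IHx.
Qed.

Lemma winning_walk gs c ux uy m x y : In (Gen c ux uy c 0 0 0) gs ->
  winning gs c (x + Z.of_nat m * ux) (y + Z.of_nat m * uy) -> winning gs c x y.
Proof. intros Hg H vx vy. eapply solvable_walk; [exact Hg | apply H]. Qed.

(** Shifting the mark by [r] moves the line x = r onto x = 0, so one climbing token serves all
    residues. *)
Lemma winning_test_x gs c c' r y : In (Gen c 0 0 c' r VX 0) gs ->
  winning gs c' (Z.of_nat r) y -> winning gs c (Z.of_nat r) y.
Proof.
  intros Hg H vx vy. eapply solvable_move; [exact Hg|].
  rewrite !Z.add_0_r, Z.sub_diag. apply (H (y + 1 :: vx) vy).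
Qed.

Lemma winning_test_y gs c c' x : In (Gen c 0 0 c' 0 VY 0) gs ->
  winning gs c' x 0 -> winning gs c x 0.
Proof.
  intros Hg H vx vy. eapply solvable_move; [exact Hg|].
  rewrite Z.add_0_r. eapply solvable_ext; [|apply (H vx (x :: vy))].
  intros phi. unfold certified. rewrite !tokens_val_cons, !tokens_val_app.
  cbn [map app]. unfold on_y at 2. rewrite !tokens_val_cons. simpl Z.of_nat.
  rewrite Z.sub_0_r, Z.add_0_r. simpl Z.add. lia.
Qed.

Lemma msteps_winning M acc c m : divisors_pos M -> msteps M c (acc, m) ->
  winning (machine_gens M acc) (stA (fst c)) (Z.of_nat (snd c)) 0.
Proof.
  intros HM H. remember (acc, m) as e eqn:Ee.
  induction H as [c|c c' c'' Hs _ IH]; subst.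
  - intros vx vy. eapply solvable_jump; [left; reflexivity|].
    apply solvable_blank, certified_solvable.
  - specialize (IH eq_refl).
    assert (HI : forall q d p q1 q2 g, nth_error M q = Some (d, p, q1, q2) ->
      In g (instr_gens q (d, p, q1, q2)) -> In g (machine_gens M acc))
      by eauto using instr_gens_in.
    destruct Hs as [q d p q1 q2 k E|q d p q1 q2 n E N]; cbn [fst snd] in *.
    + apply winning_walk with (m := k) (ux := - Z.of_nat d) (uy := 1).
      { eapply HI; [exact E|]. simpl; tauto. }
      replace (Z.of_nat (d * k) + Z.of_nat k * - Z.of_nat d) with (Z.of_nat 0) by lia.
      apply winning_test_x with (c' := stB q).
      { eapply HI; [exact E|]. simpl; tauto. }
      apply winning_walk with (m := k) (ux := Z.of_nat p) (uy := -1).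
      { eapply HI; [exact E|]. simpl; tauto. }
      replace (0 + Z.of_nat k * 1 + Z.of_nat k * -1) with 0 by lia.
      apply winning_test_y with (c' := stA q1).
      { eapply HI; [exact E|]. simpl; tauto. }
      replace (Z.of_nat 0 + Z.of_nat k * Z.of_nat p) with (Z.of_nat (p * k)) by lia.
      exact IH.
    + pose proof (HM _ _ _ _ _ E).
      set (r := (n mod d)%nat). set (k := (n / d)%nat).
      assert (Hn : n = (d * k + r)%nat) by (apply Nat.div_mod_eq).
      assert (Hr : (r < d)%nat) by (apply Nat.mod_upper_bound; lia).
      assert (Hr0 : r <> 0%nat) by (intros H0; apply (N k); lia).
      apply winning_walk with (m := k) (ux := - Z.of_nat d) (uy := 1).
      { eapply HI; [exact E|]. simpl; tauto. }
      replace (Z.of_nat n + Z.of_nat k * - Z.of_nat d) with (Z.of_nat r) by lia.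
      apply winning_test_x with (c' := stC q).
      { eapply HI; [exact E|]. apply in_or_app. right. apply in_map_iff. exists r.
        split; [reflexivity|]. apply in_seq. lia. }
      apply winning_walk with (m := k) (ux := Z.of_nat d) (uy := -1).
      { eapply HI; [exact E|]. simpl; tauto. }
      replace (0 + Z.of_nat k * 1 + Z.of_nat k * -1) with 0 by lia.
      apply winning_test_y with (c' := stA q2).
      { eapply HI; [exact E|]. simpl; tauto. }
      replace (Z.of_nat r + Z.of_nat k * Z.of_nat d) with (Z.of_nat n) by lia.
      exact IH.
Qed.

(** * Reachable tokens and the dual potential *)

Definition start_tokens (N : Z) : tokens := [(N, 0, stA 0); (0, 0, GX); (0, 2, GY)].

(** The walks preserve x + d y or x + p y, so a token remembers its number wherever it stands. In
    [reached_A] the condition [0 <= y] lets a successful test read off the quotient as the height y;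
    at a halting address no line is prescribed. *)
Inductive reached (M : list instr) (N : nat) : nat -> Z -> Z -> Prop :=
| reached_A q n x y : msteps M (0%nat, N) (q, n) -> 0 <= y ->
    (forall d p q1 q2, nth_error M q = Some (d, p, q1, q2) ->
       x + Z.of_nat d * y = Z.of_nat n) ->
    reached M N (stA q) x y
| reached_B q d p q1 q2 m x y : nth_error M q = Some (d, p, q1, q2) ->
    msteps M (0%nat, N) (q, (d * m)%nat) ->
    x + Z.of_nat p * y = Z.of_nat (p * m) -> reached M N (stB q) x y
| reached_C q d p q1 q2 n x y : nth_error M q = Some (d, p, q1, q2) ->
    msteps M (0%nat, N) (q, n) -> (forall m, n <> (d * m)%nat) ->
    x + Z.of_nat d * y = Z.of_nat n -> reached M N (stC q) x y.

(** Off its line a climbing token has to gain 1 per step to pay for the certificate it absorbs, and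
    must be at most 0 wherever it may vanish. No function on a whole line does both; the linear
    function vanishing at [B] does so up to [B], which is enough for a finite sum. *)
Definition potential (M : list instr) (N : nat) (B : Z) : place -> Z :=
  fun '(_, x, y, c) =>
    match c with
    | 1%nat => if x =? 0 then 0 else 1
    | 2%nat => if y =? 1 then 0 else 1
    | 3%nat => if x =? 0 then 0 else y - B
    | 4%nat => if y =? 2 then 0 else x - B
    | _ => if excluded_middle_informative (reached M N c x y) then 1 else 0
    end.

Lemma potential_VX M N B x y : weight (potential M N B) (true, x, y, VX) = if x =? 0 then 0 else 1.
Proof. unfold weight. simpl. destruct (x =? 0); reflexivity. Qed.

Lemma potential_VY M N B x y : weight (potential M N B) (true, x, y, VY) = if y =? 1 then 0 else 1.
Proof. unfold weight. simpl. destruct (y =? 1); reflexivity. Qed.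

Lemma potential_GX M N B x y : weight (potential M N B) (true, x, y, GX) =
  if x =? 0 then 0 else y - B.
Proof. unfold weight. cbn [snd]. change (nd 0 GX) with 1. rewrite Z.mul_1_l. reflexivity. Qed.

Lemma potential_GY M N B x y : weight (potential M N B) (true, x, y, GY) =
  if y =? 2 then 0 else x - B.
Proof. unfold weight. cbn [snd]. change (nd 0 GY) with 1. rewrite Z.mul_1_l. reflexivity. Qed.

Lemma potential_state M N B x y c : (5 <= c)%nat ->
  (reached M N c x y /\ weight (potential M N B) (true, x, y, c) = 1) \/
  (~ reached M N c x y /\ weight (potential M N B) (true, x, y, c) = 0).
Proof.
  intros Hc. do 5 (destruct c as [|c]; [lia|]). unfold weight. cbn [snd].
  change (nd 0 (S (S (S (S (S c)))))) with 1. rewrite Z.mul_1_l. unfold potential.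
  destruct (excluded_middle_informative _); auto.
Qed.

(** A move may turn a reached token into an unreached one only if its mark falls off the line: that
    false certificate is worth 1 and makes up for the loss. *)
Lemma move_nonneg M N B x y c ux uy c' o m : (5 <= c)%nat -> (5 <= c')%nat ->
  m = 0%nat \/ m = VX \/ m = VY ->
  (reached M N c x y -> m = VX -> x <> Z.of_nat o \/ reached M N c' (x + ux) (y + uy)) ->
  (reached M N c x y -> m = VY -> y <> 0 \/ reached M N c' (x + ux) (y + uy)) ->
  (reached M N c x y -> m = 0%nat -> reached M N c' (x + ux) (y + uy)) ->
  0 <= gen_val (potential M N B) x y (Gen c ux uy c' o m 0).
Proof.
  intros Hc Hc' Hm HX HY H0. unfold gen_val. cbn [src dx dy dst off mark aux].
  rewrite weight_0.
  pose proof (potential_state M N B x y c Hc) as Hsrc.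
  pose proof (potential_state M N B (x + ux) (y + uy) c' Hc') as Hdst.
  destruct Hm as [-> | [-> | ->]].
  - rewrite weight_0. intuition lia.
  - rewrite potential_VX. destruct (Z.eqb_spec (x - Z.of_nat o) 0); [|intuition lia].
    assert (x = Z.of_nat o) by lia. intuition lia.
  - rewrite potential_VY. destruct (Z.eqb_spec (y + 1) 1); [|intuition lia].
    assert (y = 0) by lia. intuition lia.
Qed.

Lemma instr_nonneg M N B x y q i g : nth_error M q = Some i -> In g (instr_gens q i) ->
  0 <= gen_val (potential M N B) x y g.
Proof.
  destruct i as [[[d p] q1] q2]. intros E Hg.
  assert (HA : reached M N (stA q) x y -> 0 <= y /\ exists n,
    msteps M (0%nat, N) (q, n) /\ x + Z.of_nat d * y = Z.of_nat n).
  { intros H. inversion H as [q' n x' y' Hst Hy Hd Hq| |]; subst.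
    - replace q' with q in * by (unfold stA in Hq; lia). eauto.
    - unfold stA, stB in *; lia.
    - unfold stA, stC in *; lia. }
  assert (HB : reached M N (stB q) x y -> exists m,
    msteps M (0%nat, N) (q, (d * m)%nat) /\ x + Z.of_nat p * y = Z.of_nat (p * m)).
  { intros H. inversion H as [|q' d' p' q1' q2' m x' y' E' Hst Hm Hq|]; subst.
    - unfold stA, stB in *; lia.
    - replace q' with q in * by (unfold stB in Hq; lia).
      rewrite E in E'. injection E' as <- <- <- <-. eauto.
    - unfold stB, stC in *; lia. }
  assert (HC : reached M N (stC q) x y -> exists n, msteps M (0%nat, N) (q, n) /\
    (forall m, n <> (d * m)%nat) /\ x + Z.of_nat d * y = Z.of_nat n).
  { intros H. inversion H as [| |q' d' p' q1' q2' n x' y' E' Hst Hm Hx Hq]; subst.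
    - unfold stA, stC in *; lia.
    - unfold stB, stC in *; lia.
    - replace q' with q in * by (unfold stC in Hq; lia).
      rewrite E in E'. injection E' as <- <- <- <-. eauto. }
  apply in_app_or in Hg. destruct Hg as [Hg|Hg].
  - destruct Hg as [<-|[<-|[<-|[<-|[<-|[<-|[]]]]]]];
      apply move_nonneg; try (unfold stA, stB, stC; lia); try (intros _; discriminate);
      auto; intros HR _.
    + destruct (HA HR) as (Hy & n & Hst & Hn). apply reached_A with (n := n); auto; [lia|].
      intros d' p' q1' q2' E'. rewrite E in E'. injection E' as <- <- <- <-. lia.
    + destruct (Z.eq_dec x (Z.of_nat 0)) as [->|]; [right | now left].
      destruct (HA HR) as (Hy & n & Hst & Hn).
      assert (n = d * Z.to_nat y)%nat as -> by (apply Nat2Z.inj; lia).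
      eapply reached_B; [exact E | exact Hst|]. lia.
    + destruct (HB HR) as (m & Hst & Hm). eapply reached_B; [exact E | exact Hst|]. lia.
    + destruct (Z.eq_dec y 0) as [->|]; [right | now left].
      destruct (HB HR) as (m & Hst & Hm).
      apply reached_A with (n := (p * m)%nat); [|lia|].
      * eapply msteps_trans; [exact Hst|]. eapply msteps_one, mstep_div, E.
      * intros. lia.
    + destruct (HC HR) as (n & Hst & Hnd & Hn).
      eapply reached_C; [exact E | exact Hst | exact Hnd|]. lia.
    + destruct (Z.eq_dec y 0) as [->|]; [right | now left].
      destruct (HC HR) as (n & Hst & Hnd & Hn).
      apply reached_A with (n := n); [|lia|].
      * eapply msteps_trans; [exact Hst|]. eapply msteps_one, mstep_ndiv; [exact E | exact Hnd].
      * intros. lia.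
  - apply in_map_iff in Hg. destruct Hg as (r & <- & Hr). apply in_seq in Hr.
    apply move_nonneg; try (unfold stA, stB, stC; lia); try (intros _; discriminate); auto.
    intros HR _. destruct (Z.eq_dec x (Z.of_nat r)) as [->|]; [right | now left].
    destruct (HA HR) as (Hy & n & Hst & Hn).
    eapply reached_C; [exact E | exact Hst | |lia].
    intros m ->.
    assert (Hrd : Z.of_nat r = Z.of_nat d * (Z.of_nat m - y)) by lia.
    assert (0 < Z.of_nat r < Z.of_nat d) by lia.
    destruct (Z.le_gt_cases (Z.of_nat m) y); nia.
Qed.

Lemma pool_nonneg M N B x y g : x <= B -> y <= B -> In g pool_gens ->
  0 <= gen_val (potential M N B) x y g.
Proof.
  intros Hx Hy Hg.
  destruct Hg as [<-|[<-|[<-|[<-|[<-|[<-|[<-|[<-|[]]]]]]]]];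
    unfold gen_val; cbn [src dx dy dst off mark aux];
    rewrite ?weight_0, ?potential_VX, ?potential_VY, ?potential_GX, ?potential_GY;
    repeat match goal with |- context [?a =? ?b] => destruct (Z.eqb_spec a b) end; lia.
Qed.
Lemma gens_bounded gs : (forall g, In g gs -> (0 < src g)%nat) ->
  exists n0, forall n, (n0 <= n)%nat -> Forall (gen_bound n) gs.
Proof.
  induction gs as [|g gs IH]; intros H.
  - exists 0%nat. constructor.
  - destruct IH as [n0 Hn0]; [intros; apply H; now right|].
    pose proof (H g (or_introl eq_refl)).
    exists (n0 + S (src g + dst g + mark g + aux g))%nat. intros n Hn. constructor.
    + unfold gen_bound. lia.
    + apply Hn0. lia.
Qed.

Lemma machine_tiles M acc : divisors_pos M ->
  exists k T, (0 < k)%nat /\ (forall t, In t T -> tile_ok k t) /\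
  forall n f, represents_tokens f (start_tokens (Z.of_nat n)) ->
    (zero_tiling_sum k 0 T f <-> exists m, msteps M (0%nat, n) (acc, m)).
Proof.
  intros HM. set (gs := machine_gens M acc).
  destruct (gens_bounded gs) as [n0 Hn0].
  { intros g Hg. apply machine_gens_inv in Hg.
    destruct Hg as [->|[Hg|(q & [[[d p] q1] q2] & _ & Hg)]].
    - simpl. unfold stA. lia.
    - simpl in Hg. destruct Hg as [<-|[<-|[<-|[<-|[<-|[<-|[<-|[<-|[]]]]]]]]]; 
        simpl; unfold VX, VY, GX, GY, stA, stB, stC; lia.
    - apply in_app_or in Hg. destruct Hg as [Hg|Hg].
      + simpl in Hg. destruct Hg as [<-|[<-|[<-|[<-|[<-|[<-|[]]]]]]]; 
        simpl; unfold VX, VY, GX, GY, stA, stB, stC; lia.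
      + apply in_map_iff in Hg. destruct Hg as (r & <- & _). simpl. unfold stA. lia. }
  (* The tokens of the input have colours up to [stA 0], which is 5. *)
  set (n1 := (n0 + 6)%nat). specialize (Hn0 n1 ltac:(lia)).
  pose proof (colors_end_le gs n1).
  exists (colors_end gs n1), (map snd (gen_chains gs n1)). split; [lia|]. split.
  { intros t Ht. apply in_map_iff in Ht. destruct Ht as ([[X Y] t'] & Ht & Hin).
    simpl in Ht. subst t'. eapply gen_chains_ok; eassumption. }
  intros n f Hf. split.
  - intros Hz. apply Classical_Prop.NNPP. intros Hno. revert Hz.
    eapply gens_sound; [exact Hf | exact Hn0 | |].
    + intros x y c [[= _ _ <-]|[[= _ _ <-]|[[= _ _ <-]|[]]]]; unfold stA, GX, GY; lia.
    + intros B. exists (potential M n B). split.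
      * unfold start_tokens. rewrite !tokens_val_cons, potential_GX, potential_GY.
        change (tokens_val _ []) with 0. simpl Z.eqb. cbn iota.
        destruct (potential_state M n B (Z.of_nat n) 0 (stA 0)) as [[_ ->]|[Hn _]];
          [unfold stA; lia | lia|].
        destruct Hn. apply reached_A with (n := n); [constructor | lia | lia].
      * intros g x y Hg Hx Hy. apply machine_gens_inv in Hg.
        destruct Hg as [->|[Hg|(q & i & E & Hg)]].
        (* The accepting generator only consumes, so it is nonnegative precisely because no token
           [stA acc] is reachable. *)
        -- unfold gen_val. cbn [src dx dy dst off mark aux]. rewrite !weight_0.
           destruct (potential_state M n B x y (stA acc)) as [[HR _]|[_ ->]];
             [unfold stA; lia | | lia].
           exfalso. apply Hno.
           inversion HR as [q' m x' y' Hst _ _ Hq| |]; subst.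
           ++ replace q' with acc in * by (unfold stA in Hq; lia). eauto.
           ++ unfold stA, stB in *; lia.
           ++ unfold stA, stC in *; lia.
        -- now apply pool_nonneg.
        -- eapply instr_nonneg; eassumption.
  - intros [m Hm]. eapply gens_complete; [exact Hf|].
    apply (msteps_winning _ _ _ _ HM) in Hm. apply (Hm [] []).
Qed.

(** * The reduction and the diagonal argument *)

(** [zdec] sends 2x to x, so coordinates appear doubled, [+ 2] is a step to the right, and the final
    2 is the coefficient 1. The colours 5, 3, 4 are [stA 0], [GX], [GY]. *)
Definition reduction (n : nat) : nat :=
  elist [elist [2 ^ n + 2 ^ n; 0; 2 ^ n + 2 ^ n + 2; 0; 5; 2];
         elist [0; 0; 2; 0; 3; 2]; elist [0; 4; 2; 4; 4; 2]]%nat.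

Lemma computable_reduction : computable 1 (fun v => reduction (nth 0 v 0%nat)).
Proof. unfold reduction. cbn [elist fold_right]. computability. Qed.

Lemma zdec_double x : zdec (x + x) = Z.of_nat x.
Proof.
  unfold zdec. replace (x + x)%nat with (2 * x)%nat by lia.
  rewrite Nat.even_mul, Nat.div2_double. reflexivity.
Qed.

Lemma entry_map_token x y c h X Y C :
  entry_map (elist [x + x; y + y; x + x + 2; y + y; c; 2]%nat) (X, Y) (edge_end h X Y) C =
  delta place_dec (h, X, Y, C) (true, Z.of_nat x, Z.of_nat y, c).
Proof.
  unfold entry_map. rewrite dlist_elist. cbn [nth].
  replace (x + x + 2)%nat with (S x + S x)%nat by lia. rewrite !zdec_double.
  replace (Z.of_nat (S x), Z.of_nat y) with (edge_end true (Z.of_nat x) (Z.of_nat y)) by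
    (unfold edge_end; f_equal; lia).
  rewrite same_edge_canonical, delta_place. change (zdec 2) with 1.
  destruct (bool_dec h true); reflexivity.
Qed.

Lemma input_map_sym n u v c : input_map n u v c = input_map n v u c.
Proof.
  unfold input_map. induction (dlist n) as [|m l IH]; [reflexivity|]. cbn [fold_right].
  rewrite IH. f_equal. unfold entry_map. cbv zeta. now rewrite (same_edge_sym u v).
Qed.

Lemma reduction_tokens n :
  represents_tokens (input_map (reduction n)) (start_tokens (Z.of_nat (2 ^ n))).
Proof.
  split; [apply input_map_sym|]. intros h X Y C.
  unfold input_map, reduction. rewrite dlist_elist. cbn [fold_right].
  rewrite (entry_map_token (2 ^ n) 0 5), (entry_map_token 0 0 3), (entry_map_token 0 2 4).
  unfold start_tokens. rewrite !tokens_val_cons. unfold weight. cbn [snd].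
  change (nd 0 (stA 0)) with 1. change (nd 0 GX) with 1. change (nd 0 GY) with 1.
  change (tokens_val _ []) with 0. change (stA 0) with 5%nat.
  change GX with 3%nat. change GY with 4%nat.
  change (Z.of_nat 0) with 0. change (Z.of_nat 2) with 2. lia.
Qed.

Theorem theorem3 :
  exists (k c0 : nat) (T : list tile),
    (c0 < k)%nat /\
    (forall t, In t T -> tile_ok k t) /\
    undecidable_nat (fun n => zero_tiling_sum k c0 T (input_map n)).
Proof.
  destruct universal_code as [u Hu].
  destruct (code_machine u) as (M & acc & HM & HMu).
  destruct (machine_tiles M acc HM) as (k & T & Hk & HT & Hkt).
  exists k, 0%nat, T. split; [exact Hk|]. split; [exact HT|].
  intros [e He]. destruct computable_reduction as [cR HR].
  destruct (Hu (Comp e [cR])) as [n Hn].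
  assert (HD : forall y, eval e [reduction n] y -> eval u [n] y).
  { intros y Hy. apply Hn. econstructor; [|exact Hy].
    constructor; [apply (HR [n] eq_refl) | constructor]. }
  specialize (Hkt _ _ (reduction_tokens n)).
  destruct (He (reduction n)) as [H0 H1].
  (* The answer 0 means solvable, but the machine accepts on nonzero values. These opposite
     conventions supply the negation of the diagonal argument. *)
  assert (HP : ~ zero_tiling_sum k 0 T (input_map (reduction n))).
  { intros HP. pose proof (HMu n 0%nat (HD _ (H0 HP))) as E. apply E; [|reflexivity].
    now apply Hkt. }
  apply HP, Hkt, (HMu n 1%nat (HD _ (H1 HP))). discriminate.
Qed.
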